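(* Let $f:S^1\to S^1$ be a multicritical circle map without periodic points. There exists a constant $K>1$, depending only on $f$, such that the following holds for every $n\ge 0$ and any two critical points $c,c'$ of $f$: if $\Delta\in\mathcal{P}_n(c)$ and $\Delta'\in\mathcal{P}_n(c')$ are two atoms such that $\Delta\cap\Delta'\ne\emptyset$, then $K^{-1}|\Delta'|\le|\Delta|\le K|\Delta'|$.
   Context: $S^1=\mathbb{R}/\mathbb{Z}$; $|I|$ is the length of an interval $I\subset S^1$. A multicritical circle map is an orientation-preserving homeomorphism $f:S^1\to S^1$ of class $C^r$, $r\ge 3$, having finitely many critical points $c_0,\dots,c_{N-1}$, $N\ge 1$, such that there exist (open) neighbourhoods $W_i\subseteq S^1$ of $c_i$ ($0\le i\le N-1$) with: (1) $f$ has negative Schwarzian derivative on $W_i\setminus\{c_i\}$; (2) there exist constants $0<\alpha_i<\beta_i$ and $s_i>1$ such that $\alpha_i|x-c_i|^{s_i-1}<f'(x)<\beta_i|x-c_i|^{s_i-1}$ for all $x\in W_i\setminus\{c_i\}$; (3) the variation of $\log f'$ on $S^1\setminus\bigcup_i W_i$ is finite. Since $f$ has no periodic points, its rotation number $\rho\in(0,1)$ is irrational; write $\rho=[a_0,a_1,\dots]=\cfrac{1}{a_0+\cfrac{1}{a_1+\cdots}}$ and $q_0=1$, $q_1=a_0$, $q_{n+1}=a_nq_n+q_{n-1}$ for $n\ge1$. For $x\in S^1$, $I_n(x)$ is the closed interval with endpoints $x$ and $f^{q_n}(x)$ that contains $f^{q_{n+2}}(x)$. The $n$-th dynamical partition associated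 with $x$ is $$\mathcal{P}_n(x)=\{f^i(I_n(x)):0\le i\le q_{n+1}-1\}\cup\{f^j(I_{n+1}(x)):0\le j\le q_n-1\},$$ a partition of $S^1$ modulo endpoints, whose elements are called atoms. *)

(* Defs.v *)
From HB Require Import structures.
From mathcomp Require Import all_boot all_order all_algebra.
From mathcomp Require Import generic_quotient.
From mathcomp Require Import all_classical all_reals all_analysis.

Set Implicit Arguments.
Unset Strict Implicit.
Unset Printing Implicit Defensive.

Import Order.TTheory GRing.Theory Num.Theory.
Import numFieldNormedType.Exports.

Local Open Scope classical_set_scope.
Local Open Scope ring_scope.

Section Circle.
Variable R : realType.
Local Open Scope quotient_scope.

Definition modZ (s t : R) : bool := s - t \is a Num.int.

Lemma modZ_refl : reflexive modZ.
Proof. by move=> s; rewrite /modZ subrr rpred0. Qed.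

Lemma modZ_sym : symmetric modZ.
Proof. by move=> s t; rewrite /modZ -opprB rpredN. Qed.

Lemma modZ_trans : transitive modZ.
Proof.
by move=> t s u st tu; rewrite /modZ -(subrK t s) -addrA rpredD.
Qed.

Canonical modZ_equiv := EquivRel modZ modZ_refl modZ_sym modZ_trans.

(* S^1 = R / Z, with the quotient topology *)
Definition circle := {eq_quot modZ_equiv}.

HB.instance Definition _ := Topological.copy circle (quotient_topology circle).
HB.instance Definition _ := Quotient.on circle.

Definition circle_proj (t : R) : circle := \pi_circle t.

Lemma circle_projP (s t : R) :
  circle_proj s = circle_proj t <-> s - t \is a Num.int.
Proof. by rewrite -[s - t \is a Num.int]/(modZ s t); split => /eqmodP. Qed.

(* quotient metric; this is the |x - y| of points of S^1 *)
Definition circle_dist (x y : circle) : R :=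
  inf [set d | exists s t : R,
    [/\ circle_proj s = x, circle_proj t = y & d = `|s - t|]].

(* closed arc from a to b in the positive direction; it is [set a] if a = b *)
Definition circle_arc (a b : circle) : set circle :=
  [set z | exists s t u : R,
    [/\ circle_proj s = a, circle_proj t = b, circle_proj u = z,
        s <= u <= t & t < s + 1]].

(* total length, i.e. normalized Lebesgue measure on S^1 *)
Definition circle_length (A : set circle) : R :=
  fine (@lebesgue_measure R (circle_proj @^-1` A `&` `[0%R, 1%R[)).

Section Maps.
Variable f : circle -> circle.

Definition circle_homeomorphism : Prop :=
  continuous f /\ exists g : circle -> circle,
    [/\ continuous g, cancel f g & cancel g f].

Definition is_lift (F : R -> R) : Prop :=
  continuous F /\ forall t, circle_proj (F t) = f (circle_proj t).

Definition orientation_preserving : Prop :=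
  exists2 F, is_lift F & {homo F : s t / s < t}.

(* Two lifts differ by an integer constant, so the notions below do not depend
   on the one that is chosen here. *)
Definition lift_of : R -> R := xget (id : R -> R) [set F | is_lift F].

Definition of_class (r : nat) : Prop :=
  (forall k, (k < r)%N -> forall t : R, derivable (derive1n k lift_of) t 1) /\
  continuous (derive1n r lift_of).

(* the k-th derivative of f as a function on S^1 *)
Definition circle_deriv (k : nat) (x : circle) : R :=
  derive1n k lift_of (repr x).

Definition critical (x : circle) : Prop := circle_deriv 1 x = 0.

Definition schwarzian (x : circle) : R :=
  circle_deriv 3 x / circle_deriv 1 x
  - 3 / 2 * (circle_deriv 2 x / circle_deriv 1 x) ^+ 2.

End Maps.

(* Variation of g on A: supremum over the finite sequences of points of A which
   go at most once around S^1 in the positive direction. *)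
Definition circle_variation (A : set circle) (g : circle -> R) : \bar R :=
  ereal_sup [set v | exists (m : nat) (t : nat -> R),
    [/\ forall k, (k < m)%N -> t k <= t k.+1,
        t m <= t 0 + 1,
        forall k, (k <= m)%N -> A (circle_proj (t k)) &
        v = (\sum_(k < m)
               `|g (circle_proj (t k.+1)) - g (circle_proj (t k))|)%:E]].

Definition multicritical_circle_map (r : nat) (f : circle -> circle) : Prop :=
  [/\ circle_homeomorphism f, orientation_preserving f, (3 <= r)%N, of_class f r &
   exists (N : nat) (c : 'I_N -> circle) (W : 'I_N -> set circle),
   [/\ [/\ (1 <= N)%N, injective c & [set x | critical f x] = range c],
       forall i, open (W i) /\ W i (c i),
       forall i x, W i x -> x <> c i -> schwarzian f x < 0,
       forall i, exists alpha beta s : R,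
         [/\ 0 < alpha, alpha < beta, 1 < s &
             forall x, W i x -> x <> c i ->
               alpha * circle_dist x (c i) `^ (s - 1) < circle_deriv f 1 x
               < beta * circle_dist x (c i) `^ (s - 1)] &
       (circle_variation (~` \bigcup_i W i) (fun x => ln (circle_deriv f 1 x))
        < +oo)%E]].

Definition no_periodic_points (f : circle -> circle) : Prop :=
  forall (x : circle) (n : nat), (0 < n)%N -> iter n f x <> x.

Definition frac_part (x : R) : R := x - (Num.floor x)%:~R.

(* the representative in [0, 1[ of Poincare's rotation number *)
Definition rotation_number (f : circle -> circle) : R :=
  frac_part (limn (fun n => iter n (lift_of f) 0 / n%:R)).

Definition gauss_map (x : R) : R := frac_part x^-1.

(* rho = 1 / (a_0 + 1 / (a_1 + ...)) with a_n = partial_quotient rho n *)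
Definition partial_quotient (rho : R) (n : nat) : nat :=
  Num.truncn (iter n gauss_map rho)^-1.

Fixpoint return_time (f : circle -> circle) (n : nat) : nat :=
  let a := partial_quotient (rotation_number f) in
  match n with
  | 0 => 1
  | n'.+1 => match n' with
             | 0 => a 0
             | n''.+1 => a n' * return_time f n' + return_time f n''
             end
  end%N.

(* I_n(x): of the two closed arcs with endpoints x and f^{q_n}(x), the one
   that contains f^{q_{n+2}}(x) *)
Definition closest_return_interval (f : circle -> circle) (n : nat)
    (x : circle) : set circle :=
  let y := iter (return_time f n) f x in
  if `[< circle_arc x y (iter (return_time f n.+2) f x) >]
  then circle_arc x y else circle_arc y x.

Definition dynamical_partition (f : circle -> circle) (n : nat) (x : circle) :
    set (set circle) :=
  [set iter i f @` closest_return_interval f n x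
    | i in [set i | (i < return_time f n.+1)%N]] `|`
  [set iter j f @` closest_return_interval f n.+1 x
    | j in [set j | (j < return_time f n)%N]].

End Circle.

(* Main.v *)
(* Everything is done for the lift F of f. Write G and H for the lifts of
   f^{q_n} and f^{q_{n+1}} that are closest to the identity.

   Composing with F multiplies the cross-ratio
   [a,b,c,d] = (b-a)(d-c) / ((c-a)(d-b)) by at most exp (Phi d - Phi a), where Phi is
   nondecreasing and Phi - V t is 1-periodic: the factor is at most 1 if the
   Schwarzian derivative is negative on [a,d], at most exp (O(d-a)) far from the
   critical points, and bounded in all cases, so that it is enough for Phi to
   have a fixed jump at each critical point. Since the intervals
   F^i([x, G x]), i < q_{n+1}, are disjoint modulo 1, the cross-ratio of four
   points of [x, G^a x] is multiplied by at most a constant under F^k,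
   k = O(q_{n+1}).

   If z minimises G x - x, the cross-ratio of G^{-1} z, z, G z, G^2 z is at least 1/4,
   so the preimages of the interval [z, G z] are bounded by their two neighbours;
   they come close to every point, which yields that G^2 x - G x and G x - x are
   comparable for every x. At a critical point c the map H is very flat; as it
   has no fixed point, |H c - c| cannot be small with respect to |G c - c|. The
   cross-ratio bound transports this comparison to f^j(c), j <= q_n. The theorem
   follows, as every atom is an interval between x and G x or between x = f^j(c),
   j < q_n, and H x. *)

Require Import Defs.
From mathcomp Require Import all_boot all_order all_algebra.
From mathcomp Require Import all_classical all_reals all_analysis.
From mathcomp Require Import ring lra zify.
Import Order.TTheory GRing.Theory Num.Theory.
Import numFieldNormedType.Exports.

Set Implicit Arguments.
Unset Strict Implicit.
Unset Printing Implicit Defensive.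

Local Open Scope classical_set_scope.
Local Open Scope ring_scope.

(** * One-variable calculus *)

(** The cross-ratio inequality is one-sided: a lower bound on a cross-ratio travels only backwards
    along an orbit, and smallness travels only forwards. This shapes every estimate. The minimal gap
    and the interval between H (H c) and H c control earlier intervals, which is why preimages of
    [z, G z] must be found near an arbitrary point, whereas the flatness at c is pushed forward.

    The distortion stays bounded uniformly in n because each estimate involves boundedly many
    fundamental intervals and boundedly many blocks of q_{n+1} iterates, while Phi and V are fixed
    once for all by f.

    No relation between the two critical points enters: the gaps x, G x are comparable wherever they
    meet, whatever x is. A critical orbit is needed only when a gap of level n has to be bounded by
    one of level n+1, since these need not be comparable at a general point.

    The arguments suppose that G moves points to the right, which is the case of even n; conjugation
    by t -> -t reduces odd n to this case. *)

Section Calculus.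
Variable R : realType.
Implicit Types (f g df : R -> R) (x y t a b : R).

Lemma periodic_argmin f : continuous f -> (forall t, f (t + 1) = f t) ->
  exists z, forall x, f z <= f x.
Proof.
move=> fc fp.
have hn (n : nat) u : f (u + n%:R) = f u.
  by elim: n u => [|n IH] u; rewrite ?addr0 // -natr1 addrA fp.
have fm (m : int) u : f (u - m%:~R) = f u.
  case: m => n; first by rewrite -[in RHS](subrK n%:~R u) hn.
  by rewrite NegzE mulrNz opprK hn.
have hc : {within `[0, 1]%classic, continuous f} by exact: continuous_subspaceT.
have [z _ hz] := EVT_min ler01 hc.
exists z => x; rewrite -(fm (Num.floor x) x); apply: hz; rewrite in_itv /=.
by have := floor_le x; have := floorD1_gt x; rewrite rmorphD /=; lra.
Qed.

Lemma periodic_bounded f : continuous f -> (forall t, f (t + 1) = f t) ->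
  exists2 M, 0 < M & forall x, `|f x| <= M.
Proof.
move=> fc fp.
have [z hz] : exists z, forall x, - `|f z| <= - `|f x|.
  apply: (@periodic_argmin (fun t => - `|f t|)) => [x|t]; last by rewrite fp.
  by apply: cvgN; apply: cvg_norm; exact: fc.
exists (`|f z| + 1); first by rewrite ltr_wpDl.
by move=> x; have := hz x; lra.
Qed.

Lemma is_derive1_continuous f df : (forall t, is_derive t 1 f (df t)) -> continuous f.
Proof.
move=> h t; apply: differentiable_continuous.
by apply/derivable1_diffP; have := h t; case.
Qed.

(** The end points may come in either order, since later uses compare a variable point with a fixed
    one on either side of it. *)
Lemma mean_value f df x y : (forall t, x <= t <= y \/ y <= t <= x -> is_derive t 1 f (df t)) ->
  exists2 xi, (x <= xi <= y \/ y <= xi <= x) & f y - f x = df xi * (y - x).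
Proof.
have main u v : u <= v -> (forall t, u <= t <= v -> is_derive t 1 f (df t)) ->
    exists2 xi, u <= xi <= v & f v - f u = df xi * (v - u).
  rewrite le_eqVlt => /orP[/eqP-> _|uv h].
    by exists v; rewrite ?lexx // !subrr mulr0.
  have [|t tuv|xi] := @MVT R f df u v uv.
  - by move=> t; rewrite in_itv /= => /andP[h1 h2]; apply: h; lra.
  - apply: derivable_within_continuous tuv => w; rewrite in_itv /= => huv.
    by have := h w huv; case.
  - by rewrite in_itv /= => /andP[h1 h2] e; exists xi => //; lra.
move=> h; have [xy|yx] := leP x y.
  have [xi h1 h2] := main x y xy (fun t ht => h t (or_introl ht)).
  by exists xi => //; left.
have [xi h1 h2] := main y x (ltW yx) (fun t ht => h t (or_intror ht)).
by exists xi; [right|lra].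
Qed.

Lemma is_derive1_mul f g x (df dg : R) : is_derive x 1 f df -> is_derive x 1 g dg ->
  is_derive x 1 (fun t => f t * g t) (df * g x + f x * dg).
Proof.
move=> h1 h2; apply: is_derive_eq (is_deriveM h1 h2) _.
by rewrite addrC [df * _]mulrC.
Qed.

Lemma is_derive1_add f g x (df dg : R) : is_derive x 1 f df -> is_derive x 1 g dg ->
  is_derive x 1 (fun t => f t + g t) (df + dg).
Proof. by move=> h1 h2; exact: is_deriveD. Qed.

Lemma is_derive1_opp f x (df : R) : is_derive x 1 f df ->
  is_derive x 1 (fun t => - f t) (- df).
Proof. by move=> h1; exact: is_deriveN. Qed.

Lemma is_derive1_inv f x (df : R) : f x != 0 -> is_derive x 1 f df ->
  is_derive x 1 (fun t => (f t)^-1) (- df / f x ^+ 2).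
Proof.
move=> fx h; apply: is_derive_eq (is_deriveV fx h) _.
by rewrite /GRing.scale /= !mulNr mulrC.
Qed.

Lemma is_derive1_cst (c x : R) : is_derive x 1 (fun=> c) 0.
Proof. exact: is_derive_cst. Qed.

Lemma is_derive1_id (x : R) : is_derive x 1 (fun t => t) 1.
Proof. exact: is_derive_id. Qed.

End Calculus.


(** * Lifts of circle homeomorphisms and their close returns *)

Section DegreeOne.
Variable R : realType.
Implicit Types (F : R -> R) (s t x y : R) (p m : int) (q k : nat).

Definition degree_one F : Prop :=
  [/\ {homo F : s t / s < t}, forall t, F (t + 1) = F t + 1 & continuous F].

(** The lifts of the [q]-th iterate of the circle map are these, one for each [p]. They commute, and
    composing them adds the indices. *)
Definition ret F q p t : R := iter q F t - p%:~R.

Variable F : R -> R.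
Hypothesis hF : degree_one F.

Lemma degree_one_lt : {mono F : s t / s < t}.
Proof. by case: hF => h _ _; apply: leW_mono; apply: le_mono. Qed.

Lemma degree_one_le : {mono F : s t / s <= t}.
Proof. by case: hF => h _ _; apply: le_mono. Qed.

Lemma degree_one_int m t : F (t + m%:~R) = F t + m%:~R.
Proof.
case: hF => _ h _.
have hn (n : nat) u : F (u + n%:R) = F u + n%:R.
  elim: n u => [|n IH] u; first by rewrite !addr0.
  by rewrite -natr1 addrA h IH addrA.
case: m => n; first exact: hn.
rewrite NegzE mulrNz -[in RHS](subrK (n.+1%:~R) t) hn.
by rewrite addrK.
Qed.

Lemma iter_degree_one_int q m t :
  iter q F (t + m%:~R) = iter q F t + m%:~R.
Proof. by elim: q => //= q ->; rewrite degree_one_int. Qed.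

Lemma iter_degree_one_lt q : {mono iter q F : s t / s < t}.
Proof. by elim: q => // q IH s t; rewrite !iterS degree_one_lt IH. Qed.

Lemma iter_degree_one_le q : {mono iter q F : s t / s <= t}.
Proof. by elim: q => // q IH s t; rewrite !iterS degree_one_le IH. Qed.

Lemma ret_lt q p : {mono ret F q p : s t / s < t}.
Proof. by move=> s t; rewrite /ret ltrD2r iter_degree_one_lt. Qed.

Lemma ret_le q p : {mono ret F q p : s t / s <= t}.
Proof. by move=> s t; rewrite /ret lerD2r iter_degree_one_le. Qed.

Lemma ret_comp q p q' p' t :
  ret F q p (ret F q' p' t) = ret F (q + q') (p + p') t.
Proof.
by rewrite /ret -mulrNz iter_degree_one_int iterD rmorphD /= mulrNz; lra.
Qed.

Lemma ret_iter q p k t : ret F q p (iter k F t) = iter k F (ret F q p t).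
Proof.
by rewrite /ret -mulrNz iter_degree_one_int -!iterD addnC.
Qed.

Lemma ret_int q p m t : ret F q p (t + m%:~R) = ret F q p t + m%:~R.
Proof. by rewrite /ret iter_degree_one_int addrAC. Qed.

Lemma ret_iter_int q p k m t :
  ret F q p (iter k F t + m%:~R) = iter (k + q) F t + (m - p)%:~R.
Proof.
by rewrite /ret iter_degree_one_int -iterD addnC rmorphB /=; lra.
Qed.

Lemma degree_one_surj y : exists x, F x = y.
Proof.
have [h1 h2 h3] := hF.
pose m := Num.floor (y - F 0).
have [] := @IVT R F m%:~R (m + 1)%:~R y.
- by rewrite ler_int; lia.
- exact: continuous_subspaceT.
- have hm : F m%:~R = F 0 + m%:~R by rewrite -degree_one_int add0r.
  have hm1 : F (m + 1)%:~R = F 0 + m%:~R + 1.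
    by rewrite rmorphD /= h2 hm.
  rewrite hm hm1.
  have := floor_le (y - F 0); have := floorD1_gt (y - F 0).
  rewrite -/m rmorphD /= => u1 u2.
  by rewrite ge_min le_max; apply/andP; split; apply/orP; [left|right]; lra.
- by move=> x _ <-; exists x.
Qed.

Lemma iter_degree_one_surj q y : exists x, iter q F x = y.
Proof.
elim: q y => [|q IH] y; first by exists y.
have [z <-] := degree_one_surj y; have [x <-] := IH z.
by exists x.
Qed.

Lemma ret_surj q p y : exists x, ret F q p x = y.
Proof.
by have [x hx] := iter_degree_one_surj q (y + p%:~R); exists x; rewrite /ret hx addrK.
Qed.

Lemma iter_degree_one_continuous q : continuous (iter q F).
Proof.
case: hF => _ _ hc.
elim: q => [|q IH] t; first exact: cvg_id.
rewrite (_ : iter q.+1 F = F \o iter q F); last exact/funext.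
by apply: continuous_comp; [exact: IH|exact: hc].
Qed.

Lemma ret_continuous q p : continuous (ret F q p).
Proof.
move=> t; apply: (@continuousB _ _ _ (iter q F) (cst p%:~R)).
  exact: iter_degree_one_continuous.
exact: cvg_cst.
Qed.

(** Orbits are ordered as those of the translation by [al], the combinatorial half of Poincare's
    theorem. Comparing iterates becomes comparing linear forms in [al], without any conjugacy. *)
Definition rotates_as F (al : R) : Prop := forall q p t,
  (t < ret F q p t) = (0 < q%:R * al - p%:~R) /\
  (ret F q p t < t) = (q%:R * al - p%:~R < 0).

Variable al : R.
Hypothesis hrot : rotates_as F al.

Lemma ret_ltE q p q' p' t :
  (ret F q p t < ret F q' p' t) =
  (q%:R * al - p%:~R < q'%:R * al - p'%:~R).
Proof.
have [le|lt] := leqP q q'.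
  have [h _] := hrot (q' - q)%N (p' - p) (ret F q p t).
  move: h; rewrite ret_comp subnK // subrK => ->.
  by rewrite natrB // mulrBl rmorphB /=; apply/idP/idP; lra.
have le := ltnW lt.
have [_ h] := hrot (q - q')%N (p - p') (ret F q' p' t).
move: h; rewrite ret_comp subnK // subrK => ->.
by rewrite natrB // mulrBl rmorphB /=; apply/idP/idP; lra.
Qed.

Lemma ret_leE q p q' p' t :
  (ret F q p t <= ret F q' p' t) =
  (q%:R * al - p%:~R <= q'%:R * al - p'%:~R).
Proof. by rewrite leNgt ret_ltE -leNgt. Qed.

Lemma ret0 t : ret F 0 0 t = t.
Proof. by rewrite /ret /= subr0. Qed.

Lemma iter_ret a q p t : iter a (ret F q p) t = ret F (a * q) (p *+ a) t.
Proof.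
elim: a => [|a IH]; first by rewrite mul0n mulr0n ret0.
by rewrite iterS IH ret_comp mulSn mulrS.
Qed.

End DegreeOne.

(** * Increments of a monotone function over disjoint intervals *)

Section DisjointIntervals.
Variable R : realType.
Variables (Phi : R -> R) (V : R).
Hypothesis Phi_ndecr : {homo Phi : s t / s <= t}.

(** The first interval [a, b] separates the others into those inside [lo, a] and those inside
    [b, hi]; induction on their number then needs no sorting. *)
Lemma sum_disjoint_intervals (s : seq (R * R)) (lo hi : R) :
  lo <= hi ->
  all (fun x => [&& lo <= x.1, x.1 <= x.2 & x.2 <= hi]) s ->
  pairwise (fun x y : R * R => (x.2 <= y.1) || (y.2 <= x.1)) s ->
  \sum_(x <- s) (Phi x.2 - Phi x.1) <= Phi hi - Phi lo.
Proof.
have [n] := ubnP (size s); elim: n s lo hi => // n IH [|[a b] s] lo hi.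
  by move=> _ h _ _; rewrite big_nil subr_ge0 Phi_ndecr.
rewrite ltnS /= => hs lohi /andP[/and3P[h1 h2 h3]] hall /andP[hab hpw].
rewrite big_cons /=.
pose P (x : R * R) := x.2 <= a.
rewrite (bigID P) /= -big_filter -[X in _ + (_ + X)]big_filter.
have := IH [seq x <- s | P x] lo a.
have := IH [seq x <- s | ~~ P x] b hi.
rewrite !size_filter => /(_ (leq_ltn_trans (count_size _ _) hs) h3) H2.
move=> /(_ (leq_ltn_trans (count_size _ _) hs) h1) H1.
have {}H1 := H1 _ (pairwise_filter _ hpw).
have {}H2 := H2 _ (pairwise_filter _ hpw).
have {}H1 : \sum_(i <- [seq x <- s | P x]) (Phi i.2 - Phi i.1) <= Phi a - Phi lo.
  apply: H1; apply/allP => x; rewrite mem_filter => /andP[Px xs].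
  by have /and3P[-> -> _] := allP hall _ xs.
have {}H2 : \sum_(i <- [seq x <- s | ~~ P x]) (Phi i.2 - Phi i.1) <= Phi hi - Phi b.
  apply: H2; apply/allP => x; rewrite mem_filter => /andP[Px xs].
  have /and3P[_ -> ->] := allP hall _ xs.
  have := allP hab _ xs => /= /orP[->//|h].
  by rewrite /P h in Px.
lra.
Qed.

Hypothesis Phi_per : forall t, Phi (t + 1) = Phi t + V.

Lemma periodic_int (m : int) t : Phi (t + m%:~R) = Phi t + V * m%:~R.
Proof.
have hn (n : nat) u : Phi (u + n%:R) = Phi u + V * n%:R.
  elim: n u => [|n IH] u; first by rewrite mulr0 !addr0.
  by rewrite -natr1 addrA Phi_per IH mulrDr addrA mulr1.
case: m => n; first exact: hn.
rewrite NegzE mulrNz -[in RHS](subrK (n.+1%:~R) t) hn.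
by rewrite mulrN addrK.
Qed.

(** Integer translations bring each left end into [0, 1[, hence each interval into [0, 2], where the
    total increment is [2 * V]. *)
Lemma sum_disjoint_mod1 (N : nat) (a b : nat -> R) :
  (forall i, a i <= b i <= a i + 1) ->
  (forall i j (m : int), (i < j < N)%N ->
     b i <= a j + m%:~R \/ b j + m%:~R <= a i) ->
  \sum_(i < N) (Phi (b i) - Phi (a i)) <= 2 * V.
Proof.
move=> hab hd.
pose s := [seq (a i - (Num.floor (a i))%:~R, b i - (Num.floor (a i))%:~R) | i <- iota 0 N].
have -> : \sum_(i < N) (Phi (b i) - Phi (a i)) = \sum_(x <- s) (Phi x.2 - Phi x.1).
  rewrite big_map -(big_mkord xpredT (fun i => Phi (b i) - Phi (a i))).
  rewrite /index_iota subn0; apply: eq_bigr => i _ /=.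
  by rewrite -mulrNz !periodic_int mulrNz; lra.
have -> : 2 * V = Phi 2 - Phi 0.
  have -> : (2 : R) = 0 + (Posz 2)%:~R by rewrite add0r.
  by rewrite periodic_int; lra.
apply: sum_disjoint_intervals => //.
  apply/allP => x /mapP[i _ ->] /=.
  have := hab i; have := floor_le (a i); have := floorD1_gt (a i).
  by rewrite rmorphD /=; lra.
rewrite pairwise_map.
apply/(pairwiseP 0%N) => i j.
rewrite !inE size_iota => iN jN ij.
rewrite !nth_iota // !add0n /=.
have := hd i j (Num.floor (a i) - Num.floor (a j)).
rewrite ij jN rmorphB /= => /(_ isT).
by case=> h; apply/orP; [left|right]; lra.
Qed.

End DisjointIntervals.

(** * Combinatorics of two consecutive close returns *)

Section CloseReturns.
Variable R : realType.
Implicit Types (F : R -> R) (al : R) (q k : nat) (p : int).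

(* (q, p), (q', p') is a pair of consecutive best approximations of [al], the
   first one from below. *)
Definition close_returns al q p (q' : nat) (p' : int) : Prop :=
  [/\ (0 < q <= q')%N, 0 < q%:R * al - p%:~R < 1,
      0 < - (q'%:R * al - p'%:~R) < q%:R * al - p%:~R &
      forall (m : nat) (s : int), (0 < m < q')%N ->
        q%:R * al - p%:~R <= `|m%:R * al - s%:~R| ].

Variables (F : R -> R) (al : R) (q q' : nat) (p p' : int).
Hypothesis hF : degree_one F.
Hypothesis hrot : rotates_as F al.
Hypothesis hq : close_returns al q p q' p'.
Local Notation G := (ret F q p).
Local Notation H := (ret F q' p').

Lemma close_ret_gt t : t < G t.
Proof. by have [-> _] := hrot q p t; case: hq => _ /andP[]. Qed.

Lemma close_ret_lt1 t : G t < t + 1.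
Proof.
have -> : t + 1 = ret F 0 (- 1) t by rewrite /ret /= rmorphN1 opprK.
by rewrite (ret_ltE hF hrot) //; case: hq => _ /andP[_]; rewrite rmorphN1; lra.
Qed.

Lemma next_ret_lt t : H t < t.
Proof. by have [_ ->] := hrot q' p' t; case: hq => _ _ /andP[]; lra. Qed.

Lemma next_close_ret_gt t : t < H (G t).
Proof.
rewrite ret_comp //; have [-> _] := hrot (q' + q)%N (p' + p) t.
by rewrite natrD rmorphD /=; case: hq => _ _ /andP[] h1 h2 _; lra.
Qed.

(** An overlap would make [j - i], which is less than [q'], a denominator approximating [al] better
    than [q] does, against the last clause of [close_returns]. *)
Lemma iter_intervals_disjoint u i j (s : int) : (i < j < q')%N ->
  iter i F (G u) <= iter j F u + s%:~R \/ iter j F (G u) + s%:~R <= iter i F u.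
Proof.
move=> /andP[ij jq]; case: hq => _ /andP[d0 _] _ hbest.
have /(hbest (j - i)%N (- s)) : (0 < j - i < q')%N by lia.
have ej : j = (i + (j - i))%N by lia.
rewrite ler_normr => /orP[] h; [left|right].
  have : G u <= ret F (j - i) (- s) u by rewrite (ret_leE hF hrot).
  rewrite -(iter_degree_one_le hF i) => /le_trans; apply.
  rewrite /ret rmorphN opprK iter_degree_one_int // -iterD.
  by rewrite -ej.
have : ret F (j - i + q) (- s + p) u <= ret F 0 0 u.
  by rewrite (ret_leE hF hrot) //; move: h; rewrite natrD !rmorphD /= !rmorphN /=; lra.
rewrite ret0 -ret_comp // -(iter_degree_one_le hF i); apply: le_trans.
rewrite {2}/ret rmorphN opprK -/(G u) iter_degree_one_int //.
by rewrite -iterD -ej.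
Qed.

Variables (Phi : R -> R) (V : R).
Hypothesis Phi_ndecr : {homo Phi : s t / s <= t}.
Hypothesis Phi_per : forall t, Phi (t + 1) = Phi t + V.

Lemma sum_fundamental_interval u :
  \sum_(i < q') (Phi (iter i F (G u)) - Phi (iter i F u)) <= 2 * V.
Proof.
apply: (sum_disjoint_mod1 Phi_ndecr Phi_per (a := fun i => iter i F u)
  (b := fun i => iter i F (G u))) => [i|i j m ij]; last first.
  exact: iter_intervals_disjoint.
rewrite /= -ret_iter // ltW ?close_ret_gt //=.
exact/ltW/close_ret_lt1.
Qed.

(** The interval is covered by [a] adjacent fundamental intervals and the time by [b] blocks of [q']
    iterates; each of the [a * b] pairs costs [2 * V]. A later block is a first block with base
    point moved by [iter q' F], so the bound is needed for all base points. *)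
Lemma sum_iter_intervals (a b k : nat) u v :
  u <= v -> v <= iter a G u -> (k <= b * q')%N ->
  \sum_(i < k) (Phi (iter i F v) - Phi (iter i F u)) <= 2 * (a * b)%:R * V.
Proof.
move=> uv va kb.
have iF i : {homo iter i F : x y / x <= y}.
  by move=> x y xy; rewrite iter_degree_one_le.
have term_ge0 i : 0 <= Phi (iter i F v) - Phi (iter i F u).
  by rewrite subr_ge0; apply/Phi_ndecr/iF.
have h1 : \sum_(i < k) (Phi (iter i F v) - Phi (iter i F u)) <=
   \sum_(i < b * q') (Phi (iter i F v) - Phi (iter i F u)).
  rewrite -!(big_mkord xpredT (fun i => Phi (iter i F v) - Phi (iter i F u))).
  rewrite [leRHS](big_cat_nat (n := k)) //= lerDl.
  exact: sumr_ge0.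
apply: (le_trans h1).
have h2 : \sum_(i < b * q') (Phi (iter i F v) - Phi (iter i F u)) <=
  \sum_(i < b * q') (Phi (iter i F (iter a G u)) - Phi (iter i F u)).
  by apply: ler_sum => i _; rewrite lerD2r; apply/Phi_ndecr/iF.
apply: (le_trans h2) => {h1 h2 uv va term_ge0}.
elim: b u {kb v} => [|b IH] u; first by rewrite big_ord0 muln0 mulr0 mul0r.
rewrite mulSn -(big_mkord xpredT (fun i => Phi (iter i F (iter a G u)) - Phi (iter i F u))).
rewrite (big_cat_nat (n := q')) //= ?leq_addr //.
rewrite -{2}[q']add0n big_addn addKn !big_mkord.
have -> : 2 * (a * b.+1)%:R * V = a%:R * (2 * V) + 2 * (a * b)%:R * V.
  by rewrite !natrM -natr1; ring.
apply: lerD; last first.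
  have -> : \sum_(i < b * q') (Phi (iter (i + q') F (iter a G u)) - Phi (iter (i + q') F u))
    = \sum_(i < b * q') (Phi (iter i F (iter a G (iter q' F u))) - Phi (iter i F (iter q' F u))).
    apply: eq_bigr => i _; rewrite !iterD; congr (Phi _ - _); congr iter.
    by rewrite !iter_ret // ret_iter.
  exact: IH.
elim: a {IH} => [|a IHa]; first by rewrite mul0r big1 // => i _; rewrite subrr.
rewrite -natr1 mulrDl mul1r iterS.
have := sum_fundamental_interval (iter a G u).
move: IHa; set s1 := bigop _ _ _; set s2 := bigop _ _ _; set s3 := bigop _ _ _.
have -> : s3 = s1 + s2.
  by rewrite /s1 /s2 /s3 -big_split /=; apply: eq_bigr => i _; lra.
lra.
Qed.

(** Take the largest point [v j] of the orbit segment modulo 1 that does not exceed [z]. If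
    [j <= q'], its image by G is still in the segment, hence not below [z], and it is at most G z.
    If [j > q'], its preimage by H plays this role: it lies to the right of [v j], and H (G z)
    exceeds z. *)
Lemma orbit_meets_fundamental_interval x z :
  exists (k : nat) (s : int), (k <= q + q')%N /\
    z <= iter k F x - s%:~R <= G z.
Proof.
have q0 : (0 < q <= q')%N by case: hq.
pose fl (i : nat) := Num.floor (z - iter i F x).
pose v i := iter i F x + (fl i)%:~R.
have vz i : v i <= z by rewrite /v; have := floor_le (z - iter i F x); rewrite -/(fl i); lra.
have vmax i (s : int) : iter i F x + s%:~R <= z -> iter i F x + s%:~R <= v i.
  move=> h; rewrite /v lerD2l ler_int /fl floor_ge_int; lra.
pose j := [arg max_(i > (ord0 : 'I_(q + q').+1)) v i]%O.
have jmax (i : nat) : (i <= q + q')%N -> v i <= v j.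
  move=> iq; rewrite /j; case: Order.TotalTheory.arg_maxP => // j0 _.
  by move=> /(_ (Ordinal (iq : (i < (q + q').+1)%N)) isT).
have jb : (j <= q + q')%N by rewrite -ltnS; exact: ltn_ord.
have Gv : G (v j) <= G z by rewrite ret_le.
have [jq'|jq'] := leqP j q'.
  exists (j + q)%N, (p - fl j); split; first lia.
  have -> : iter (j + q) F x - (p - fl j)%:~R = G (v j).
    by rewrite /v ret_iter_int // !rmorphB /=; lra.
  rewrite Gv andbT leNgt; apply/negP => lt.
  have := close_ret_gt (v j); rewrite ltNge => /negP; apply.
  have e : G (v j) = iter (j + q) F x + (fl j - p)%:~R.
    by rewrite /v ret_iter_int // rmorphB /=; lra.
  move/ltW: lt; rewrite e => /vmax /le_trans; apply; apply: jmax; lia.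
exists (j - q')%N, (- (fl j + p')); split; first lia.
set w := _ - _.
have Hw : H w = v j.
  rewrite /w -mulrNz ret_iter_int // subnK ?(ltnW jq') // /v.
  by rewrite opprK rmorphB rmorphD /=; lra.
apply/andP; split.
  rewrite leNgt; apply/negP => lt.
  have := next_ret_lt w; rewrite Hw ltNge => /negP; apply.
  move/ltW: lt; rewrite /w -mulrNz => /vmax /le_trans; apply; apply: jmax; lia.
rewrite -(ret_le hF q' p') Hw (le_trans (vz j)) //.
exact/ltW/next_close_ret_gt.
Qed.

End CloseReturns.

(** * Cross-ratio distortion and bounded geometry *)

Section CrossRatio.
Variable R : realType.
Implicit Types (F Phi : R -> R) (V : R).

Definition cross_ratio (a b c d : R) : R :=
  (b - a) * (d - c) / ((c - a) * (d - b)).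

Definition cr_control F Phi V : Prop :=
  [/\ {homo Phi : s t / s <= t}, forall t, Phi (t + 1) = Phi t + V &
      forall a b c d, a < b -> b < c -> c < d ->
        cross_ratio (F a) (F b) (F c) (F d) <=
        expR (Phi d - Phi a) * cross_ratio a b c d].

Lemma cr_control_ge0 F Phi V : cr_control F Phi V -> 0 <= V.
Proof.
case=> h1 h2 _; have : Phi 0 <= Phi (0 + 1) by apply: h1; lra.
by rewrite h2; lra.
Qed.

Lemma cr_iter F Phi V k a b c d : degree_one F -> cr_control F Phi V ->
  a < b -> b < c -> c < d ->
  cross_ratio (iter k F a) (iter k F b) (iter k F c) (iter k F d) <=
  expR (\sum_(i < k) (Phi (iter i F d) - Phi (iter i F a))) * cross_ratio a b c d.
Proof.
move=> hF [_ _ hc] ab bc cd.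
elim: k => [|k IH]; first by rewrite big_ord0 expR0 mul1r.
rewrite big_ord_recr /= [_ + (_ - _)]addrC expRD -mulrA.
have lt x y : x < y -> iter k F x < iter k F y by rewrite iter_degree_one_lt.
apply: (le_trans (hc _ _ _ _ (lt _ _ ab) (lt _ _ bc) (lt _ _ cd))).
by rewrite ler_wpM2l // expR_ge0.
Qed.

Lemma cross_ratio_prod_le B (a b c d a' b' c' d' : R) :
  a < b -> b < c -> c < d -> a' < b' -> b' < c' -> c' < d' ->
  cross_ratio a' b' c' d' <= B * cross_ratio a b c d ->
  ((b' - a') * (d' - c')) * ((c - a) * (d - b)) <=
  B * ((b - a) * (d - c)) * ((c' - a') * (d' - b')).
Proof.
move=> ab bc cd ab' bc' cd'; rewrite /cross_ratio.
have pos u v w x : u < v -> v < w -> w < x -> 0 < (w - u) * (x - v) :> R.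
  by move=> *; apply: mulr_gt0; lra.
have p1 := pos _ _ _ _ ab bc cd.
have p2 := pos _ _ _ _ ab' bc' cd'.
by rewrite mulrA ler_pdivrMr // mulrAC ler_pdivlMr.
Qed.

End CrossRatio.

(** Here [l], [r] are the outer intervals of a configuration, [t], [v] the two overlapping ones, and
    primes denote images. The factor [r] cancels against [v]; comparing the other lengths with [D]
    costs [9 * e ^+ 2] for [t' * v'] and [e ^+ 2] for [r' * t]. *)
Lemma cross_ratio_lower_bound (S : realFieldType) (A e D l l' r r' t t' v v' : S) :
  0 < A -> 0 < e -> 0 < D -> 0 < l -> 0 < l' -> 0 < r -> 0 < r' -> 0 < t' -> 0 < v' ->
  l' * r' * (t * v) <= A * (l * r) * (t' * v') -> r <= v ->
  D <= e * r' -> D <= e * t -> t' <= 3 * (e * D) -> v' <= 3 * (e * D) ->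
  l' <= 9 * A * e ^+ 4 * l.
Proof.
move=> A0 e0 D0 l0 l'0 r0 r'0 t'0 v'0 hh rv r'D tD t'D v'D.
have Al0 : 0 < A * l := mulr_gt0 A0 l0.
have h1 : l' * r' * t <= A * l * (t' * v').
  have v0 : 0 < v := lt_le_trans r0 rv.
  rewrite -(ler_pM2r v0) -(mulrA _ t v); apply: (le_trans hh).
  have -> : A * (l * r) * (t' * v') = A * l * (t' * v') * r by ring.
  by rewrite ler_wpM2l // ltW // !mulr_gt0.
have h2 : t' * v' <= 9 * e ^+ 2 * D ^+ 2.
  have -> : 9 * e ^+ 2 * D ^+ 2 = (3 * (e * D)) * (3 * (e * D)) by ring.
  by apply: ler_pM => //; exact: ltW.
have h3 : l' * (D * D) <= e ^+ 2 * (l' * r' * t).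
  have -> : e ^+ 2 * (l' * r' * t) = l' * ((e * r') * (e * t)) by ring.
  by rewrite ler_pM2l //; apply: ler_pM => //; exact: ltW.
rewrite -(ler_pM2r (mulr_gt0 D0 D0)); apply: (le_trans h3).
apply: (le_trans (ler_wpM2l (ltW (exprn_gt0 2 e0)) h1)).
have := ler_wpM2l (ltW (mulr_gt0 (exprn_gt0 2 e0) Al0)) h2.
by rewrite -mulrA => /le_trans; apply; rewrite le_eqVlt; apply/orP; left; apply/eqP; ring.
Qed.

(** * Real bounds: consecutive gaps are comparable *)

Section RealBounds.
Variable R : realType.
Variable V : R.

(** Points within [m] fundamental intervals followed during [n * q'] iterates cost
    [expR (2 * (m * n) * V)]; the exponent allows [m * n] up to 50, the largest product used being 3
    * 9. *)
Definition distortion : R := expR (100 * V).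
Local Notation B := distortion.
(** Seven consecutive gaps are compared, with at most six steps of ratio [4 * B] between two of
    them. *)
Definition gap_ratio : R := (4 * B) ^+ 6.
Local Notation E := gap_ratio.
(** The product of the two factors of [gap_comparable_aux]: [2 * E] from above and
    [E * (1 + 9 * B * E ^+ 4)] from below. *)
Definition geometry_bound : R := 2 * E ^+ 2 * (1 + 9 * B * E ^+ 4).
Local Notation C := geometry_bound.

Hypothesis V0 : 0 <= V.

Lemma distortion_ge1 : 1 <= B.
Proof. by rewrite /distortion -expR0 ler_expR mulr_ge0. Qed.

Lemma gap_ratio_ge1 : 1 <= E.
Proof. by rewrite exprn_ege1 //; have := distortion_ge1; lra. Qed.

Lemma geometry_bound_ge1 : 1 <= C.
Proof.
have B1 := distortion_ge1; have E1 := gap_ratio_ge1.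
rewrite /C; set e2 := E ^+ 2; set e4 := E ^+ 4.
have h2 : 1 <= e2 by exact: exprn_ege1.
have h4 : 0 <= 9 * B * e4 by rewrite !mulr_ge0 //; lra.
nra.
Qed.

Variables (F : R -> R) (al : R) (q q' : nat) (p p' : int) (Phi : R -> R).
Hypothesis hF : degree_one F.
Hypothesis hrot : rotates_as F al.
Hypothesis hq : close_returns al q p q' p'.
Hypothesis hcr : cr_control F Phi V.
Local Notation G := (ret F q p).
Local Notation H := (ret F q' p').
Local Notation gap x := (G x - x).

Let Ggt x : x < G x. Proof. exact: close_ret_gt hrot hq _. Qed.
Let Gle := ret_le hF q p.

Lemma gap_gt0 x : 0 < gap x.
Proof. by rewrite subr_gt0 (close_ret_gt hrot hq). Qed.

Lemma cr_ret (m n k : nat) (s : int) a b c d :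
  a < b -> b < c -> c < d -> d <= iter m G a -> (k <= n * q')%N ->
  (m * n <= 50)%N ->
  ((ret F k s b - ret F k s a) * (ret F k s d - ret F k s c)) *
    ((c - a) * (d - b)) <=
  B * ((b - a) * (d - c)) *
    ((ret F k s c - ret F k s a) * (ret F k s d - ret F k s b)).
Proof.
move=> ab bc cd da kn mn.
apply: cross_ratio_prod_le; rewrite ?ret_lt //.
have -> : cross_ratio (ret F k s a) (ret F k s b) (ret F k s c) (ret F k s d) =
  cross_ratio (iter k F a) (iter k F b) (iter k F c) (iter k F d).
  by rewrite /cross_ratio /ret; congr (_ * _ / (_ * _)); lra.
apply: (le_trans (cr_iter k hF hcr ab bc cd)).
apply: ler_wpM2r.
  by rewrite /cross_ratio mulr_ge0 ?invr_ge0 ?mulr_ge0 //; lra.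
rewrite ler_expR.
have [h1 h2 _] := hcr.
have ad : a <= d by lra.
apply: (le_trans (sum_iter_intervals hF hrot hq h1 h2 ad da kn)).
apply: ler_wpM2r => //.
rewrite (_ : 100 = 2 * 50%:R); last by rewrite -natrM.
by rewrite ler_pM2l // ler_nat.
Qed.

Lemma gap_argmin : exists z, forall x, gap z <= gap x.
Proof.
apply: (@periodic_argmin _ (fun x => gap x)) => [x|t].
  by apply: cvgB; [exact: ret_continuous|exact: cvg_id].
by rewrite -[t + 1]/(t + 1%:~R) ret_int //; lra.
Qed.

(** The image configuration has a smallest gap in its middle, so its cross-ratio is at least 1/4 and
    that of the original at least [1 / (4 * B)]. With L, M, N the gaps at w, G w, G (G w), this
    reads [(L + M) * (M + N) <= 4 * B * (L * N)], and keeping a single product on the left gives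
    each claim. *)
Lemma gap_near_argmin z w k s : (forall x, gap z <= gap x) ->
  (k <= 9 * q')%N -> ret F k s (G w) = z ->
  gap (G w) <= 4 * B * gap w /\ gap (G w) <= 4 * B * gap (G (G w)).
Proof.
move=> zmin kq hz.
have B1 := distortion_ge1.
have comm x : ret F k s (G x) = G (ret F k s x).
  by rewrite !ret_comp // addnC addrC.
have := @cr_ret 3 9 k s w (G w) (G (G w)) (G (G (G w))).
move=> /(_ (Ggt _) (Ggt _) (Ggt _) (lexx _) kq isT).
rewrite !comm -comm hz -/(G _).
set zm := ret F k s w.
have hzm : G zm = z by rewrite /zm -comm.
have := zmin zm; rewrite hzm.
have := zmin (G z); have := gap_gt0 z.
have := gap_gt0 w; have := gap_gt0 (G w); have := gap_gt0 (G (G w)).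
set L := gap w; set M := gap (G w); set N := gap (G (G w)).
set m := gap z; set N' := G (G z) - G z; set L' := z - zm.
have -> : G (G w) - w = L + M by rewrite /L /M; lra.
have -> : G (G (G w)) - G w = M + N by rewrite /N /M; lra.
have -> : G z - zm = L' + m by rewrite /L' /m; lra.
have -> : G (G z) - z = m + N' by rewrite /N' /m; lra.
move=> N0 M0 L0 m0 mN' mL' hh.
have h1 : (L + M) * (M + N) <= 4 * B * (L * N).
  have p1 : 0 < L' * N' by apply: mulr_gt0; lra.
  have h2 : (L' + m) * (m + N') <= 4 * (L' * N').
    have -> : 4 * (L' * N') = (L' + L') * (N' + N') by ring.
    by apply: ler_pM; lra.
  rewrite -(ler_pM2l p1); apply: (le_trans hh).
  have p2 : 0 <= B * (L * N) by rewrite !mulr_ge0; lra.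
  apply: (le_trans (ler_wpM2l p2 h2)).
  by rewrite le_eqVlt; apply/orP; left; apply/eqP; ring.
have LM : 0 < L * M by exact: mulr_gt0.
have LN : 0 < L * N by exact: mulr_gt0.
have MN : 0 < M * N by exact: mulr_gt0.
have MM : 0 < M * M by exact: mulr_gt0.
split.
  by rewrite -(ler_pM2r N0); lra.
by rewrite -(ler_pM2l L0); lra.
Qed.

(** The gaps listed here lie among seven consecutive ones that are all carried onto the minimal gap,
    at times bounded by a multiple of [q']. *)
Lemma comparable_gaps x : exists2 y, y <= x <= G y &
  forall i, (i <= 5)%N -> gap (iter i G y) <= E * gap (iter 2 G y) /\
                        gap (iter 2 G y) <= E * gap (iter i G y).
Proof.
have B1 := distortion_ge1.
have [/andP[q0 qq'] _ _ _] := hq.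
have [z zmin] := gap_argmin.
(* The gaps carried forward onto [z, G z] lie to the left of its preimage, so the preimage is sought
   five steps to the right of [x]. *)
have [k [s [kq]]] := orbit_meets_fundamental_interval hF hrot hq (iter 5 G x) z.
have [W hW] := ret_surj hF k s z.
rewrite -[iter k F _ - _]/(ret F k s _).
(* [W] is the preimage of [z], and the gaps at G y0, ..., G^7 y0 = W all reach the gap at [z], the
   first one after [k + 6 * q <= 8 * q'] iterates. Two of these gaps remain available to the right
   of index 5. *)
have [y0 hy0] : exists y0, iter 7 G y0 = W.
  by have [y0] := ret_surj hF (7 * q) (p *+ 7) W; rewrite -iter_ret // => <-; exists y0.
have comm (u : R) : ret F k s (G u) = G (ret F k s u).
  by rewrite !ret_comp // addnC addrC.
rewrite -hW -comm !(ret_le hF k s) -hy0 => hx.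
have le5 u v : (iter 5 G u <= iter 5 G v) = (u <= v).
  by rewrite !iter_ret // ret_le.
have {}hx : iter 2 G y0 <= x <= iter 3 G y0.
  by move: hx; rewrite -iterS (iterD 5 2) (iterD 5 3) !le5.
have ratio i : (i < 7)%N -> gap (iter i.+1 G y0) <= 4 * B * gap (iter i G y0) /\
   gap (iter i.+1 G y0) <= 4 * B * gap (iter i.+2 G y0).
  move=> i7; rewrite !iterS.
  apply: (@gap_near_argmin z _ (k + (6 - i) * q) (s + p *+ (6 - i)) zmin); first nia.
  rewrite -ret_comp // -iter_ret // -iterS -iterD -hW -hy0; congr ret.
  by congr iter; lia.
have up i n : (i + n < 7)%N ->
   gap (iter (i + n).+1 G y0) <= (4 * B) ^+ n * gap (iter i.+1 G y0).
  elim: n => [|n IH] h; first by rewrite addn0 mul1r.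
  rewrite addnS exprS -mulrA; have [h1 _] := ratio (i + n).+1 ltac:(lia).
  apply: (le_trans h1); rewrite ler_pM2l; last lra.
  by apply: IH; lia.
have dn i n : (i + n < 7)%N ->
   gap (iter i.+1 G y0) <= (4 * B) ^+ n * gap (iter (i + n).+1 G y0).
  elim: n => [|n IH] h; first by rewrite addn0 mul1r.
  rewrite exprSr -mulrA; apply: (le_trans (IH _)); first lia.
  rewrite ler_pM2l ?exprn_gt0 //; last lra.
  have [_ h1] := ratio (i + n)%N ltac:(lia).
  by rewrite addnS.
have pw n i : (n <= 6)%N -> (4 * B) ^+ n * gap (iter i G y0) <= E * gap (iter i G y0).
  move=> n6; rewrite ler_pM2r ?gap_gt0 // ler_weXn2l //; lra.
have all i j : (i < 7)%N -> (j < 7)%N -> gap (iter i.+1 G y0) <= E * gap (iter j.+1 G y0).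
  move=> i7 j7; have [ij|ji] := leqP i j.
    by rewrite -(subnKC ij); apply: (le_trans (dn _ (j - i)%N _)); [lia|apply: pw; lia].
  by rewrite -(subnKC (ltnW ji)); apply: (le_trans (up _ (i - j)%N _)); [lia|apply: pw; lia].
exists (iter 2 G y0); first exact: hx.
move=> i i5; rewrite -!iterD addn2; split; apply: all => //; lia.
Qed.

(** A small gap at [x] would force a small gap at G x, by the cross-ratio of x, G x, G (G x), G^4 y
    under G itself. But the two gaps together cover [G y, G (G y)], whose length is comparable with
    [D]. *)
Lemma gap_comparable_aux y x (D : R) : y <= x <= G y ->
  (forall i, (i <= 4)%N -> gap (iter i G y) <= E * D /\
                        D <= E * gap (iter i G y)) ->
  D <= E * (1 + 9 * B * E ^+ 4) * gap x /\ gap x <= 2 * E * D.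
Proof.
move=> /andP[yx xy] hD.
have [/andP[q0 qq'] _ _ _] := hq.
have B1 := distortion_ge1; have E1 := gap_ratio_ge1.
have [u0 _] := hD 0%N isT; have [u1 d1] := hD 1%N isT; have [u2 d2] := hD 2%N isT.
have [u3 d3] := hD 3%N isT; have [u4 d4] := hD 4%N isT.
move: (gap_gt0 y) u0 u1 u2 u3 u4 d1 d2 d3 d4; rewrite /= => g0 u0 u1 u2 u3 u4 d1 d2 d3 d4.
have x1 : G x <= G (G y) by rewrite Gle.
have x2 : G (G x) <= G (G (G y)) by rewrite !Gle.
have x3 : G (G (G x)) <= G (G (G (G y))) by rewrite !Gle.
have z1 : G y <= G x by rewrite Gle.
have z2 : G (G y) <= G (G x) by rewrite !Gle.
have gx0 := gap_gt0 x; have gx1 := gap_gt0 (G x); have gx2 := gap_gt0 (G (G x)).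
have g1 := gap_gt0 (G y); have g2 := gap_gt0 (G (G y)).
have g3 := gap_gt0 (G (G (G y))); have g4 := gap_gt0 (G (G (G (G y)))).
have D0 : 0 < D by rewrite -(pmulr_rgt0 D (_ : 0 < E)); lra.
split; last by lra.
have := @cr_ret 4 1 q p x (G x) (G (G x)) (iter 4 G y).
rewrite /= mul1n.
have a1 : G (G x) < G (G (G (G y))) by lra.
have a2 : G (G (G (G y))) <= G (G (G (G x))) by rewrite !Gle.
move=> /(_ (Ggt _) (Ggt _) a1 a2 qq' isT).
set l := G x - x; set l' := gap (G x).
set r := G (G (G (G y))) - G (G x); set r' := G (G (G (G (G y)))) - G (G (G x)).
set t := G (G x) - x; set t' := G (G (G x)) - G x.
set v := G (G (G (G y))) - G x; set v' := G (G (G (G (G y)))) - G (G x).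
move=> hh.
have rv : r <= v by rewrite /r /v; lra.
have r0 : 0 < r by rewrite /r; lra.
have r'D : D <= E * r' by rewrite /r'; nra.
have tD : D <= E * t by rewrite /t; nra.
have t'D : t' <= 3 * (E * D) by rewrite /t'; lra.
have v'D : v' <= 3 * (E * D) by rewrite /v'; lra.
have tE : t = l + l' by rewrite /t /l /l'; lra.
have l0 : 0 < l by exact: gx0.
have l'0 : 0 < l' by exact: gx1.
have t'0 : 0 < t' by rewrite /t'; lra.
have v'0 : 0 < v' by rewrite /v'; lra.
have r'0 : 0 < r' by rewrite /r'; lra.
have B0 : 0 < B := lt_le_trans ltr01 B1.
have E0 : 0 < E := lt_le_trans ltr01 E1.
have h4 : l' <= 9 * B * E ^+ 4 * l.
  exact: (cross_ratio_lower_bound B0 E0 D0 l0 l'0 r0 r'0 t'0 v'0 hh rv r'D tD).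
rewrite -mulrA; apply: (le_trans tD).
rewrite (ler_pM2l E0) tE.
have -> : (1 + 9 * B * E ^+ 4) * l = l + 9 * B * E ^+ 4 * l by ring.
by rewrite lerD2l.
Qed.

(** The pairs (y, x) and (G y, G x) are compared with the same [D]; the shift of base point is why
    [comparable_gaps] goes one index further than [gap_comparable_aux]. *)
Theorem bounded_geometry x :
  gap (G x) <= C * gap x /\ gap x <= C * gap (G x).
Proof.
have B1 := distortion_ge1; have E1 := gap_ratio_ge1.
have [y hy hD] := comparable_gaps x.
set D := gap (iter 2 G y) in hD.
have [] := @gap_comparable_aux y x D hy.
  by move=> i i4; apply: hD; lia.
have hy' : G y <= G x <= G (G y) by rewrite !Gle.
have [] := @gap_comparable_aux (G y) (G x) D hy'.
  by move=> i i4; rewrite -iterSr; apply: hD; lia.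
set P := E * _ => a1 a2 b1 b2.
have E0 : 0 <= 2 * E by lra.
have -> : C = 2 * E * P by rewrite /C /P; ring.
rewrite -!(mulrA (2 * E)); split.
  by apply: (le_trans a2); apply: ler_wpM2l.
by apply: (le_trans b2); apply: ler_wpM2l.
Qed.
End RealBounds.

(** [x1], [x2] are the outer intervals, [x3], [x4] the overlapping ones, and the [y] are their
    images. A relatively short [x2] has a relatively short image, because [y3] and [y4] are bounded
    by the other data. *)
Lemma flat_image_small (S : realFieldType) (A K lam D x1 x2 x3 x4 y1 y2 y3 y4 : S) :
  0 < A -> 0 < K -> 0 < lam -> 0 < x1 -> x1 <= x3 -> 0 < x2 -> 0 < x4 ->
  0 < y1 -> 0 < y2 -> 0 < y3 -> 0 < y4 ->
  y1 * y2 * (x3 * x4) <= A * (x1 * x2) * (y3 * y4) ->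
  x2 <= (2 * A * (1 + K) ^+ 2)^-1 * lam * x4 ->
  y4 <= (1 + K) * D -> y3 <= (1 + K) * y1 -> y2 <= lam * D / 2.
Proof.
move=> A0 K0 lam0 x10 x31 x20 x40 y10 y20 y30 y40 hh hx hy4 hy3.
set k := 1 + K in hx hy4 hy3 *; have k0 : 0 < k by rewrite /k addr_gt0.
have x30 : 0 < x3 := lt_le_trans x10 x31.
have h1 : y1 * y2 * x4 <= A * x2 * (y3 * y4).
  rewrite -(ler_pM2l x30).
  have -> : x3 * (y1 * y2 * x4) = y1 * y2 * (x3 * x4) by ring.
  apply: (le_trans hh).
  have -> : A * (x1 * x2) * (y3 * y4) = x1 * (A * x2 * (y3 * y4)) by ring.
  by rewrite ler_pM2r // !mulr_gt0.
have h2 : y3 * y4 <= y1 * (k ^+ 2 * D).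
  have -> : y1 * (k ^+ 2 * D) = (k * y1) * (k * D) by ring.
  by apply: ler_pM => //; exact: ltW.
have D0 : 0 < D by rewrite -(pmulr_rgt0 D k0); exact: lt_le_trans hy4.
have h3 : A * x2 * (y3 * y4) <= y1 * x4 * (lam * D / 2).
  have Ax2 : 0 <= A * x2 by rewrite ltW // mulr_gt0.
  apply: (le_trans (ler_wpM2l Ax2 h2)).
  have w : 0 <= A * y1 * k ^+ 2 * D by rewrite ltW // !mulr_gt0 // exprn_gt0.
  have := ler_wpM2l w hx.
  have -> : A * y1 * k ^+ 2 * D * x2 = A * x2 * (y1 * (k ^+ 2 * D)) by ring.
  move=> /le_trans; apply; rewrite le_eqVlt; apply/orP; left; apply/eqP.
  by field; rewrite ?gt_eqF.
have yx : 0 < y1 * x4 := mulr_gt0 y10 x40.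
rewrite -(ler_pM2l yx); apply: le_trans h3.
by apply: le_trans h1; rewrite le_eqVlt; apply/orP; left; apply/eqP; ring.
Qed.

(** If the middle interval [M'] of the image is not large with respect to its neighbours, the
    cross-ratio of the image is bounded below; so is then that of the source, and [M] cannot be
    large either. *)
Lemma cross_ratio_forward (S : realFieldType) (A K k L M N L' M' N' : S) :
  0 < A -> 0 < K -> 0 < L -> 0 < M -> 0 < N -> 0 < L' -> 0 < M' -> 0 < N' ->
  M' <= K * N' -> M' <= k * L' ->
  N' * L' * ((M + N) * (L + M)) <= A * (N * L) * ((M' + N') * (L' + M')) ->
  M <= A * (1 + K) * (1 + k) * L.
Proof.
move=> A0 K0 L0 M0 N0 L'0 M'0 N'0 h1 h2 hh.
have k0 : 0 < k by rewrite -(pmulr_lgt0 _ L'0) (lt_le_trans M'0).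
have h3 : (M' + N') * (L' + M') <= ((1 + K) * N') * ((1 + k) * L').
  by apply: ler_pM; rewrite ?mulrDl ?mul1r ?lerD2l // ?[_ + N']addrC ?lerD2l // ltW // addr_gt0.
have NL : 0 < N * L := mulr_gt0 N0 L0.
have NL' : 0 < N' * L' := mulr_gt0 N'0 L'0.
have h4 : (M + N) * (L + M) <= A * (1 + K) * (1 + k) * (N * L).
  rewrite -(ler_pM2l NL'); apply: (le_trans hh).
  apply: (le_trans (ler_wpM2l (ltW (mulr_gt0 A0 NL)) h3)).
  by rewrite le_eqVlt; apply/orP; left; apply/eqP; ring.
rewrite -(ler_pM2l N0).
have -> : N * (A * (1 + K) * (1 + k) * L) = A * (1 + K) * (1 + k) * (N * L) by ring.
apply: le_trans h4.
have -> : (M + N) * (L + M) = N * M + (M * L + M * M + N * L) by ring.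
by rewrite lerDl ltW // !addr_gt0 // mulr_gt0.
Qed.

(** * Comparison of consecutive scales along critical orbits *)

Section CriticalOrbits.
Variable R : realType.
Variable V : R.
Hypothesis V0 : 0 <= V.
Local Notation B := (distortion V).
Local Notation C := (geometry_bound V).

(** Chosen so that H contracts [t, c] in [critical_gap] to at most half its length: [B] is the
    distortion, each [1 + C] bounds one image length, and 2 gives the half. *)
Definition flatness : R := (2 * B * (1 + C) ^+ 2)^-1.

Variables (F : R -> R) (al : R) (q q' : nat) (p p' : int) (Phi : R -> R).
Hypothesis hF : degree_one F.
Hypothesis hrot : rotates_as F al.
Hypothesis hq : close_returns al q p q' p'.
Hypothesis hcr : cr_control F Phi V.
Local Notation G := (ret F q p).
Local Notation H := (ret F q' p').
Local Notation gap x := (G x - x).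

Let Ggt x : x < G x. Proof. exact: close_ret_gt hrot hq _. Qed.
Let Gle := ret_le hF q p.
Let cr_ret := cr_ret V0 hF hrot hq hcr.
Let bounded_geometry := bounded_geometry V0 hF hrot hq hcr.


(* If c - H c were small compared with the gap at [c], then by flatness H would
   map the left neighbourhood of [c] so close to H c that H t > t there. *)
Lemma critical_gap lam c : 0 < lam < 1 ->
  (forall D, 0 < D <= 1 ->
     F c - F (c - lam * D) <= flatness * lam * (F c - F (c - D))) ->
  gap c <= 2 * C / lam * (c - H c).
Proof.
move=> /andP[lam0 lam1] hflat.
have [/andP[q0 qq'] _ _ _] := hq.
have B1 := distortion_ge1 V0; have C1 := geometry_bound_ge1 V0.
have B0 : 0 < B := lt_le_trans ltr01 B1.
have C0 : 0 < C := lt_le_trans ltr01 C1.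
have [y Gy] := ret_surj hF q p c.
have [e Ge] := ret_surj hF q p y.
pose D := c - y; pose t := c - lam * D.
have D0 : 0 < D by rewrite /D subr_gt0 -Gy Ggt.
have D1 : D <= 1.
  by rewrite /D -Gy; have := close_ret_lt1 hF hrot hq y => h; rewrite lerBlDl ltW.
have lD0 : 0 < lam * D by apply: mulr_gt0.
have lD : lam * D < D by rewrite gtr_pMl.
have ey : e < y by rewrite -Ge Ggt.
have yt : y < t by rewrite /t; move: lD; rewrite /D; lra.
have tc : t < c by rewrite /t; move: lD0; lra.
have Hret u : H u = ret F q'.-1 p' (F u).
  by rewrite /ret -iterSr prednK // (leq_trans q0).
have Flt u v : (F u < F v) = (u < v) by rewrite degree_one_lt.
(* The flatness acts in the first application of F, to e = G^-2 c, y = G^-1 c, t and c; the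
   cross-ratio bound takes care of the [q'.-1] iterates that follow. *)
have := cr_ret (m := 2%N) (n := 1%N) (k := q'.-1) p' (a := F e) (b := F y) (c := F t) (d := F c).
rewrite !Flt -!Hret => /(_ ey yt tc).
have -> : iter 2 G (F e) = F c.
  by rewrite /= -[F e]/(iter 1 F e) !ret_iter // Ge Gy.
rewrite mul1n => /(_ (lexx _) (leq_pred _) isT) hh.
have comm u : H (G u) = G (H u) by rewrite !ret_comp // addnC addrC.
have HyE : H y = G (H e) by rewrite -comm Ge.
have HcE : H c = G (H y) by rewrite -comm Gy.
have [b1 _] := bounded_geometry (H e); have [_ b2] := bounded_geometry e.
rewrite -HyE -HcE in b1; rewrite Ge Gy in b2.
have Hlt u v : (H u < H v) = (u < v) by rewrite ret_lt.
have o1 : H e < H y by rewrite Hlt.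
have o2 : H y < H t by rewrite Hlt.
have o3 : H t < H c by rewrite Hlt.
have eHy : e < H y by rewrite -Ge (next_close_ret_gt hF hrot hq).
have [b5 _] := bounded_geometry y; rewrite Gy -/D in b5.
have hf := hflat D; rewrite D0 D1 in hf; have {}hf := hf isT.
rewrite -/t (_ : c - D = y) in hf; last by rewrite /D; lra.
have Ht : H t < t by exact: next_ret_lt hrot hq _.
have key : H c - H t <= lam * D / 2.
  have Fy0 : 0 < F y - F e by rewrite subr_gt0 Flt.
  have Ft0 : 0 < F t - F y by rewrite subr_gt0 Flt.
  have Fc0 : 0 < F c - F t by rewrite subr_gt0 Flt.
  have D2 : H c - H y <= (1 + C) * D by move: (next_ret_lt hrot hq c) eHy b2; rewrite /D; lra.
  have D3 : H t - H e <= (1 + C) * (H y - H e) by move: b1 o3; lra.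
  move: hh hf D2 D3; rewrite /flatness.
  set x1 := F y - F e in Fy0 *; set x2 := F c - F t in Fc0 *.
  set x3 := F t - F e; set x4 := F c - F y.
  have x31 : x1 <= x3 by rewrite /x1 /x3; move: Ft0; lra.
  have x40 : 0 < x4 by rewrite /x4; move: Ft0 Fc0; rewrite /x2; lra.
  set y1 := H y - H e; set y2 := H c - H t; set y3 := H t - H e; set y4 := H c - H y.
  have y10 : 0 < y1 by rewrite subr_gt0.
  have y20 : 0 < y2 by rewrite subr_gt0.
  have y30 : 0 < y3 by rewrite subr_gt0 (lt_trans o1).
  have y40 : 0 < y4 by rewrite subr_gt0 (lt_trans o2).
  exact: (flat_image_small B0 C0 lam0 Fy0 x31 Fc0 x40 y10 y20 y30 y40).
apply: (le_trans b5).
have : lam * D <= 2 * (c - H c) by move: key Ht; rewrite /t; lra.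
move=> h.
have -> : 2 * C / lam * (c - H c) = C * (2 * (c - H c) / lam) by ring.
by rewrite ler_pM2l // ler_pdivlMr // mulrC.
Qed.

(** The lift of the remaining [q' - j] iterates sends F^j u to H u, hence H y to H (H c) and y to H
    c, where y = F^j c. There the comparison is known, and the cross-ratio brings it back to y. The
    times [j <= q] suffice, as these are the ones occurring in the second family of atoms. *)
Lemma orbit_gap c kap j : (j <= q)%N -> 0 < kap -> gap c <= kap * (c - H c) ->
  c - H c <= C * (H c - H (H c)) ->
  gap (iter j F c) <=
    C * (1 + B * (1 + C) * (1 + (C + C ^+ 2 + C ^+ 3) * kap * C)) *
      (iter j F c - H (iter j F c)).
Proof.
move=> jq kap0 hkap hH.
have [/andP[q0 qq'] _ _ _] := hq.
have B1 := distortion_ge1 V0; have C1 := geometry_bound_ge1 V0.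
have B0 : 0 < B := lt_le_trans ltr01 B1.
have C0 : 0 < C := lt_le_trans ltr01 C1.
have [y0 Gy0] := ret_surj hF q p c.
have [e0 Ge0] := ret_surj hF q p y0.
have [e1 Ge1] := ret_surj hF q p e0.
pose y := iter j F c; pose e := iter j F e0.
have GGe : G (G e) = y by rewrite /e !ret_iter // Ge0 Gy0.
have comm u : H (G u) = G (H u) by rewrite !ret_comp // addnC addrC.
have HGgt u : u < G (H u) by rewrite -comm (next_close_ret_gt hF hrot hq).
have Hret u : ret F (q' - j) p' (iter j F u) = H u.
  by rewrite /ret -iterD subnK // (leq_trans jq).
have KG u : ret F (q' - j) p' (G u) = G (ret F (q' - j) p' u).
  by rewrite !ret_comp // addnC addrC.
have KH u : ret F (q' - j) p' (H (iter j F u)) = H (H u).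
  by rewrite (ret_iter hF q' p' j) Hret.
have kA : ret F (q' - j) p' (H e) = H (H e0) by rewrite /e KH.
have kB : ret F (q' - j) p' (G (H e)) = H (H y0) by rewrite KG kA -!comm Ge0.
have kC : ret F (q' - j) p' (H y) = H (H c) by rewrite /y KH.
have kD : ret F (q' - j) p' y = H c by rewrite /y Hret.
have HyE : H y = G (G (H e)) by rewrite -GGe !comm.
have := cr_ret (m := 3%N) (n := 1%N) (k := (q' - j)%N) p' (a := H e)
  (b := G (H e)) (c := H y) (d := y).
rewrite mul1n leq_subr kA kB kC kD.
have o1 : H y < y := next_ret_lt hrot hq y.
have o2 : y <= iter 3 G (H e) by rewrite -GGe /= !Gle ltW.
have o0 : G (H e) < H y by rewrite HyE Ggt.
move=> /(_ (Ggt _) o0 o1 o2 isT isT) hh.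
have o3 : e1 < H (H y0).
  have HG u : u < H (G u) := next_close_ret_gt hF hrot hq u.
  by rewrite -Ge0 -Ge1 (comm (G e1)); exact: lt_trans (HG e1) (HG _).
have b1 := bounded_geometry e1; have b0 := bounded_geometry e0.
have by0 := bounded_geometry y0; have bu := bounded_geometry (H (H e0)).
have be := bounded_geometry (G e).
move: b1 b0 by0 bu be; rewrite Ge1 Ge0 Gy0 -!comm !(Ge0, Gy0) GGe.
move=> [_ b1] [_ b0] [_ by0] [bu _] [be _].
set K := (C + C ^+ 2 + C ^+ 3) * kap * C.
have Lt u : H u < u := next_ret_lt hrot hq u.
(* The left side lies in [e1, c] with e1 = G^-3 c, that is in three consecutive gaps, of lengths at
   most C, C^2 and C^3 times the gap at c. *)
have Mle : H (H c) - H (H y0) <= K * (H c - H (H c)).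
  have h1 : H (H c) - H (H y0) <= (C + C ^+ 2 + C ^+ 3) * gap c.
    have h2 : e0 - e1 <= C * (C * (C * gap c)).
      by apply: (le_trans b1); rewrite ler_pM2l // (le_trans b0) // ler_pM2l.
    have h3 : y0 - e0 <= C * (C * gap c) by apply: (le_trans b0); rewrite ler_pM2l.
    have -> : (C + C ^+ 2 + C ^+ 3) * gap c =
      C * gap c + C * (C * gap c) + C * (C * (C * gap c)) by ring.
    have := Lt c; have := Lt (H c); move: h2 h3 by0 o3; clear hh; lra.
  apply: (le_trans h1); rewrite /K -(mulrA _ kap) -(mulrA _ (kap * C)) ler_pM2l; last first.
    by rewrite !addr_gt0 ?exprn_gt0.
  by apply: (le_trans hkap); rewrite -(mulrA kap) ler_pM2l.
have yGe : y - G e <= y - G (H e) by rewrite lerD2l lerN2 Gle ltW.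
rewrite -/y; apply: (le_trans be); rewrite -(mulrA C) ler_pM2l //.
apply: (le_trans yGe).
have Hc1 : H (H e0) < H (H y0) by rewrite !ret_lt // -Ge0 Ggt.
have Hc2 : H (H y0) < H (H c) by rewrite !ret_lt // -Gy0 Ggt.
have pos (u v : R) : u < v -> 0 < v - u by rewrite subr_gt0.
have := cross_ratio_forward B0 C0 (pos _ _ o1) (pos _ _ o0) (pos _ _ (Ggt (H e)))
  (pos _ _ (Lt (H c))) (pos _ _ Hc2) (pos _ _ Hc1) bu Mle.
set b := B * (1 + C) * (1 + K).
have -> : H y - G (H e) + (G (H e) - H e) = H y - H e by lra.
have -> : y - H y + (H y - G (H e)) = y - G (H e) by lra.
have -> : H (H c) - H (H y0) + (H (H y0) - H (H e0)) = H (H c) - H (H e0) by lra.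
have -> : H c - H (H c) + (H (H c) - H (H y0)) = H c - H (H y0) by lra.
move=> /(_ hh) hM; rewrite mulrDl mul1r.
by move: hM; rewrite -/b; lra.
Qed.

End CriticalOrbits.

(** * Distortion of cross-ratios by a multicritical map *)

Section NegativeSchwarzian.
Variable R : realType.
Variables (F f1 f2 f3 : R -> R) (a d : R).
Hypothesis F1 : forall t : R, is_derive t 1 F (f1 t).
Hypothesis F2 : forall t : R, is_derive t 1 f1 (f2 t).
Hypothesis F3 : forall t : R, is_derive t 1 f2 (f3 t).
Hypothesis f1_gt0 : forall t, a <= t <= d -> 0 < f1 t.
Hypothesis schw : forall t, a <= t <= d ->
  f3 t / f1 t - 3 / 2 * (f2 t / f1 t) ^+ 2 < 0.

(* The Schwarzian derivative of [F] is [- 2 v'' / v] for this [v]. *)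
Let v t := expR (- 2^-1 * ln (f1 t)).
Let P t := f2 t / f1 t.

Let v_gt0 t : 0 < v t. Proof. exact: expR_gt0. Qed.

Let v_sqr t : a <= t <= d -> f1 t = (v t ^+ 2)^-1.
Proof.
move=> ht; rewrite /v -expRM_natl -expRN -[LHS]lnK ?posrE ?f1_gt0 //; congr expR.
by field.
Qed.

Let v_derive t : a <= t <= d -> is_derive t 1 v (- (P t / 2) * v t).
Proof.
move=> ht; have f0 := f1_gt0 ht.
have h1 := is_derive1_comp (is_derive1_ln f0) (F2 t).
have h2 := is_derive1_mul (is_derive1_cst (- 2^-1) t) h1.
have h3 := is_derive1_comp (is_derive_expR _) h2.
apply: (is_derive_eq h3); rewrite /v /P /=; field.
by rewrite gt_eqF.
Qed.

Let vp_derive t : a <= t <= d ->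
  is_derive t 1 (fun t => - (P t / 2) * v t)
   (- 2^-1 * v t * (f3 t / f1 t - 3 / 2 * (f2 t / f1 t) ^+ 2)).
Proof.
move=> ht; have f0 := f1_gt0 ht.
have fn : f1 t != 0 by rewrite gt_eqF.
have h1 := is_derive1_mul (F3 t) (is_derive1_inv fn (F2 t)).
have h2 := is_derive1_mul (is_derive1_opp (is_derive1_mul h1 (is_derive1_cst (2^-1) t)))
  (v_derive ht).
by apply: (is_derive_eq h2); rewrite /P; field.
Qed.

(** Since v'' > 0, [v] is convex, and the left side is the value at [x] of its tangent at [y], of
    slope [- (P y / 2) * v y]. *)
Let v_tangent x y : a <= x <= d -> a <= y <= d ->
  v y * (1 + P y / 2 * (y - x)) <= v x.
Proof.
move=> hx hy.
have in_ad t : x <= t <= y \/ y <= t <= x -> a <= t <= d by case; lra.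
have [xi hxi e] := mean_value (fun t ht => v_derive (in_ad t ht)).
have in_ad' t : xi <= t <= y \/ y <= t <= xi -> a <= t <= d by case; case: hxi; lra.
have [z hz e'] := mean_value (fun t ht => vp_derive (in_ad' t ht)).
have q0 : 0 <= (y - x) * (y - xi) by case: hxi => h; nra.
have : 0 < - 2^-1 * v z * (f3 z / f1 z - 3 / 2 * (f2 z / f1 z) ^+ 2).
  have := schw (in_ad' _ hz); have := v_gt0 z.
  by set S := _ - _ => ??; rewrite mulNr mulNr -mulrN !mulr_gt0 // oppr_gt0.
move: e'; set S := - 2^-1 * v z * _; set w := - (P y / 2) * v y => e' S0.
have : 0 <= (w - - (P xi / 2) * v xi) * (y - x).
  by rewrite e' -mulrA [(y - xi) * _]mulrC; apply: mulr_ge0 => //; exact: ltW.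
move: e; set w' := - (P xi / 2) * v xi.
have -> : v y * (1 + P y / 2 * (y - x)) = v y - w * (y - x) by rewrite /w; ring.
nra.
Qed.

(** The Moebius map with the same value and first two derivatives as [F] at [y] corresponds to the
    tangent of [v]. As [v] lies above it, [F] has the smaller derivative and moves less far from F y
    on both sides. Multiplying by the denominator of the Moebius map keeps the statement meaningful
    beyond its pole. *)
Let mobius_osculation y t : a <= y <= d -> a <= t <= d ->
  0 <= (t - y) * (f1 y * (t - y) - (F t - F y) * (1 + P y / 2 * (y - t))).
Proof.
move=> hy ht.
have f0 := f1_gt0 hy.
set k := P y / 2.
have in_ad s : y <= s <= t \/ t <= s <= y -> a <= s <= d by case; lra.
have Fmono : 0 <= (t - y) * (F t - F y).
  have [xi hxi ->] := @mean_value R F f1 y t (fun s _ => F1 s).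
  rewrite mulrCA -expr2 mulr_ge0 ?sqr_ge0 //.
  exact/ltW/f1_gt0/in_ad.
(* At or beyond the pole the subtracted product is nonpositive, so that nothing has to be
   compared. *)
have [w0|w0] := leP (1 + k * (y - t)) 0.
  by have := mulr_ge0 (ltW f0) (sqr_ge0 (t - y)); nra.
have w_gt0 s : y <= s <= t \/ t <= s <= y -> 0 < 1 + k * (y - s).
  have [k0|k0] := leP 0 k; case=> h; nra.
pose psi s := f1 y * (y - s) * (1 + k * (y - s))^-1 - (F y - F s).
have dpsi s : y <= s <= t \/ t <= s <= y ->
  is_derive s 1 psi (f1 s - f1 y / (1 + k * (y - s)) ^+ 2).
  move=> hs; have wn : 1 + k * (y - s) != 0 by rewrite gt_eqF ?w_gt0.
  have h1 := is_derive1_add (is_derive1_cst y s) (is_derive1_opp (is_derive1_id s)).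
  have h2 := is_derive1_mul (is_derive1_cst (f1 y) s) h1.
  have h3 := is_derive1_add (is_derive1_cst 1 s) (is_derive1_mul (is_derive1_cst k s) h1).
  have h4 := is_derive1_mul h2 (is_derive1_inv (f := fun s => 1 + k * (y - s)) wn h3).
  have h5 := is_derive1_add (is_derive1_cst (F y) s) (is_derive1_opp (F1 s)).
  apply: (is_derive_eq (is_derive1_add h4 (is_derive1_opp h5))).
  by field.
have [xi hxi e] := mean_value dpsi.
have : f1 xi - f1 y / (1 + k * (y - xi)) ^+ 2 <= 0.
  have wx := w_gt0 _ hxi; have vy := v_gt0 y.
  rewrite subr_le0 (v_sqr (in_ad _ hxi)) (v_sqr hy) -invfM -exprMn.
  rewrite lef_pV2 ?posrE ?exprn_gt0 ?mulr_gt0 //.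
  rewrite ler_pXn2r // ?nnegrE; first by apply: v_tangent => //; exact: in_ad.
    exact/ltW/mulr_gt0.
  exact: ltW.
move: e; set S := _ - f1 y / _ => e S0.
have psiy : psi y = 0 by rewrite /psi !subrr mulr0 mul0r subrr.
have : (t - y) * psi t <= 0.
  have -> : psi t = S * (t - y) by rewrite -e psiy subr0.
  by have := sqr_ge0 (t - y); nra.
rewrite /psi => h.
have := mulr_le0_ge0 h (ltW w0).
have -> : (t - y) * (f1 y * (y - t) / (1 + k * (y - t)) - (F y - F t)) * (1 + k * (y - t))
  = - ((t - y) * (f1 y * (t - y) - (F t - F y) * (1 + k * (y - t)))).
  by field; rewrite gt_eqF.
by rewrite oppr_le0.
Qed.

(** With [a] and [d] fixed, the inequality says [r c <= r b]; [r] decreases because [F] stays below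
    its osculating Moebius map at y, seen from both [a] and [d]. *)
Lemma neg_schwarzian_cross_ratio b c : a < b -> b < c -> c < d ->
  cross_ratio (F a) (F b) (F c) (F d) <= cross_ratio a b c d.
Proof.
move=> ab bc cd.
have Finc x y : a <= x -> x < y -> y <= d -> 0 < F y - F x.
  move=> ax xy yd; have [xi hxi ->] := @mean_value R F f1 x y (fun s _ => F1 s).
  by rewrite mulr_gt0 ?subr_gt0 //; apply: f1_gt0; case: hxi; lra.
pose r y := (F d - F y) * (y - a) * ((d - y) * (F y - F a))^-1.
have in_ad y : b <= y <= c \/ c <= y <= b -> a < y < d by case; lra.
have dr y : b <= y <= c \/ c <= y <= b -> is_derive y 1 r
   (((F d - F y) - f1 y * (y - a)) * ((d - y) * (F y - F a))^-1 -
    (F d - F y) * (y - a) * ((d - y) * f1 y - (F y - F a)) / ((d - y) * (F y - F a)) ^+ 2).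
  move=> /in_ad hy.
  have A0 := @Finc a y (lexx _) ltac:(lra) ltac:(lra).
  have B0 := @Finc y d ltac:(lra) ltac:(lra) (lexx _).
  have n1 : (d - y) * (F y - F a) != 0 by rewrite mulf_neq0 // gt_eqF //; lra.
  have h1 := is_derive1_add (is_derive1_cst (F d) y) (is_derive1_opp (F1 y)).
  have h2 := is_derive1_add (is_derive1_id y) (is_derive1_opp (is_derive1_cst a y)).
  have h3 := is_derive1_add (is_derive1_cst d y) (is_derive1_opp (is_derive1_id y)).
  have h4 := is_derive1_add (F1 y) (is_derive1_opp (is_derive1_cst (F a) y)).
  have h5 := is_derive1_mul (is_derive1_mul h1 h2) (is_derive1_inv (f := fun y => (d - y) * (F
    y - F a)) n1 (is_derive1_mul h3 h4)).
  by apply: (is_derive_eq h5); ring.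
have [y hy] := mean_value dr.
set S := (X in _ = X * _) => e.
have S0 : S <= 0.
  rewrite /S => {e S}.
  have /andP[ay yd] := in_ad _ hy.
  have A0 := @Finc a y (lexx _) ay (ltW yd).
  have B0 := @Finc y d (ltW ay) yd (lexx _).
  have hy' : a <= y <= d by lra.
  have o1 := @mobius_osculation y a hy' ltac:(lra).
  have o2 := @mobius_osculation y d hy' ltac:(lra).
  move: A0 B0 o1 o2; set k := P y / 2; set g := f1 y.
  set A := F y - F a; set B := F d - F y => A0 B0.
  have -> : F a - F y = - A by rewrite /A; ring.
  have u0 : 0 < y - a by lra.
  have w0 : 0 < d - y by lra.
  move=> o1 o2.
  have {}o1 : A * (1 + k * (y - a)) <= g * (y - a).
    rewrite -subr_ge0 -(pmulr_lge0 _ u0); apply: le_trans o1 _.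
    by rewrite le_eqVlt; apply/orP; left; apply/eqP; ring.
  have {}o2 : B * (1 - k * (d - y)) <= g * (d - y).
    rewrite -subr_ge0 -(pmulr_lge0 _ w0); apply: le_trans o2 _.
    by rewrite le_eqVlt; apply/orP; left; apply/eqP; ring.
  set u := y - a in u0 o1 *; set w := d - y in w0 o2 *.
  have wA : 0 < w * A by exact: mulr_gt0.
  have -> : (B - g * u) / (w * A) - B * u * (w * g - A) / (w * A) ^+ 2 =
     ((B - g * u) * (w * A) - B * u * (w * g - A)) / (w * A) ^+ 2.
    by field; rewrite !gt_eqF.
  rewrite pmulr_lle0 ?invr_gt0 ?exprn_gt0 //.
  (* With the weights [B * w] and [A * u] the second order coefficient [k] cancels from the sum of
     the two inequalities. *)
  have := ler_wpM2l (ltW (mulr_gt0 B0 w0)) o1.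
  have := ler_wpM2l (ltW (mulr_gt0 A0 u0)) o2.
  by move=> i1 i2; nra.
have rr : r c <= r b.
  by rewrite -subr_le0 e mulr_le0_ge0 //; lra.
move: rr; rewrite /r /cross_ratio.
have p1 := @Finc a b (lexx _) ab ltac:(lra).
have p2 := @Finc a c (lexx _) ltac:(lra) ltac:(lra).
have p3 := @Finc b d ltac:(lra) ltac:(lra) (lexx _).
have p4 := @Finc c d ltac:(lra) ltac:(lra) (lexx _).
rewrite ler_pdivrMr; last by rewrite mulr_gt0 //; lra.
rewrite mulrAC ler_pdivlMr; last by rewrite mulr_gt0 //; lra.
move=> h; rewrite ler_pdivrMr ?mulr_gt0 // mulrAC ler_pdivlMr; last first.
  by rewrite mulr_gt0; lra.
by move: h; lra.
Qed.

End NegativeSchwarzian.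

Lemma fin_uniform_pos (R : realType) (I : finType) (P : I -> R -> Prop) :
  (forall i e e', 0 < e' -> e' <= e -> P i e -> P i e') ->
  (forall i, exists2 e, 0 < e & P i e) ->
  exists2 e, 0 < e & forall i, P i e.
Proof.
move=> anti h.
have [e e0 he] : exists2 e, 0 < e & forall i, i \in enum I -> P i e.
  elim: (enum I) => [|j s [e e0 IH]]; first by exists 1.
  have [e' e'0 hj] := h j.
  have m0 : 0 < Num.min e e' by rewrite lt_min e0.
  exists (Num.min e e') => // i; rewrite inE => /orP[/eqP->|/IH].
    by apply: anti hj; rewrite // ge_min lexx orbT.
  by apply: anti; rewrite // ge_min lexx.
by exists e => // i; apply: he; rewrite mem_enum.
Qed.

Lemma is_derive_periodic (R : realType) (f df : R -> R) (k : R) :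
  (forall t : R, is_derive t 1 f (df t)) -> (forall t, f (t + 1) = f t + k) ->
  forall t, df (t + 1) = df t.
Proof.
move=> h hp t.
have h1 := is_derive1_comp (g := fun t => t + 1) (h (t + 1)) (is_derive1_add (is_derive1_id t)
  (is_derive1_cst 1 t)).
have h2 := is_derive1_add (h t) (is_derive1_cst k t).
have e : f \o (fun t => t + 1) = (fun t => f t + k) by apply/funext => u /=; rewrite hp.
rewrite e in h1.
by have := @derive_val _ _ _ _ _ _ _ h1; rewrite (@derive_val _ _ _ _ _ _ _ h2) !addr0 mulr1 => ->.
Qed.

Lemma periodic_shift (R : realType) (f : R -> R) :
  (forall t, f (t + 1) = f t) -> forall (m : int) t, f (t + m%:~R) = f t.
Proof.
move=> h m t.
have h0 u : f (u + 1) = f u + 0 by rewrite addr0.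
by rewrite (periodic_int h0) mul0r addr0.
Qed.

(** * The power law near one critical point *)

Section PowerLaw.
Variable R : realType.
Variables (F f1 : R -> R) (c rho al be s : R).
Hypothesis F1 : forall t : R, is_derive t 1 F (f1 t).
Hypothesis Fle : forall x y, x <= y -> F x <= F y.
Hypothesis al0 : 0 < al.
Hypothesis be0 : 0 < be.
Hypothesis s1 : 1 < s.
Hypothesis f1c : f1 c = 0.
Hypothesis rho0 : 0 < rho.
Hypothesis hpow : forall t, t <> c -> `|t - c| < rho ->
  al * `|t - c| `^ (s - 1) < f1 t < be * `|t - c| `^ (s - 1).

Let sm : 0 <= s - 1. Proof. by move: s1; lra. Qed.

Let pow_le x y : 0 <= x -> x <= y -> x `^ (s - 1) <= y `^ (s - 1).
Proof. by move=> x0 xy; apply: ge0_ler_powR; rewrite // nnegrE //; lra. Qed.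

Let f1_le t mu : `|t - c| < rho -> `|t - c| <= mu -> f1 t <= be * mu `^ (s - 1).
Proof.
move=> h1 h2; have [->|/eqP tc] := eqVneq t c.
  by rewrite f1c mulr_ge0 ?powR_ge0 // ltW.
have /andP[_ /ltW/le_trans] := hpow tc h1; apply.
by rewrite ler_wpM2l ?pow_le // ltW.
Qed.

Let incr_ge mu u v : 0 < mu -> u <= v ->
  (forall t, u <= t <= v -> mu <= `|t - c| < rho) ->
  al * mu `^ (s - 1) * (v - u) <= F v - F u.
Proof.
move=> mu0 uv h.
have [t ht ->] := @mean_value R F f1 u v (fun s _ => F1 s).
have /h/andP[h1 h2] : u <= t <= v by case: ht; lra.
rewrite ler_wpM2r ?subr_ge0 //.
have tc : t <> c by move=> e; move: h1; rewrite e subrr normr0; lra.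
have /andP[/ltW + _] := hpow tc h2; apply: le_trans.
by rewrite ler_wpM2l ?pow_le // ltW.
Qed.

(** Let mu be the distance from [c] to the farther end of [x, y]. The quarter of [x, y] at that end
    stays at distance at least mu / 2 from [c], so the growth of F on it dominates the derivative at
    any point, which is at most [be * mu ^ (s - 1)]. *)
Lemma power_law_slope : exists2 C : R, 0 < C & forall x y t : R,
  c - rho < x -> x < y -> y < c + rho -> x <= t <= y ->
  f1 t * (y - x) <= C * (F y - F x).
Proof.
have h0 : 0 < 2^-1 `^ (s - 1) :> R by rewrite powR_gt0 // invr_gt0.
exists (4 * be / (al * 2^-1 `^ (s - 1))).
  by rewrite divr_gt0 ?mulr_gt0.
move=> x y t xr xy yr xty.
have concl mu u v : 0 < mu -> x <= u -> u <= v -> v <= y -> v - u = (y - x) / 4 ->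
    `|t - c| <= mu -> (forall w, u <= w <= v -> mu / 2 <= `|w - c| < rho) ->
    f1 t * (y - x) <= 4 * be / (al * 2^-1 `^ (s - 1)) * (F y - F x).
  move=> mu0 xu uv vy e tmu hw.
  have mu2 : 0 < mu / 2 by rewrite divr_gt0.
  have h1 := incr_ge mu2 uv hw.
  have tr : `|t - c| < rho by rewrite ltr_norml; lra.
  have h2 := f1_le tr tmu.
  have yx : 0 < y - x by lra.
  apply: (le_trans (ler_wpM2r (ltW yx) h2)).
  have h3 : F v - F u <= F y - F x by have := Fle xu; have := Fle vy; lra.
  have k0 : 0 < 4 * be / (al * 2^-1 `^ (s - 1)) by rewrite divr_gt0 ?mulr_gt0.
  apply: le_trans (ler_wpM2l (ltW k0) (le_trans h1 h3)).
  rewrite e powRM ?(ltW mu0) ?invr_ge0 // le_eqVlt; apply/orP; left; apply/eqP.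
  by field; rewrite !gt_eqF.
have [far|far] := leP `|x - c| (y - c).
  have mu0 : 0 < y - c.
    rewrite lt_neqAle (le_trans _ far) // andbT; apply/eqP => e.
    move: far; rewrite -e normr_le0 subr_eq0 => /eqP; lra.
  have := far; rewrite ler_norml => /andP[f1' f2'].
  apply: (concl (y - c) ((x + 3 * y) / 4) y) => //; try lra.
    by rewrite ler_norml; lra.
  by move=> w hw; rewrite ger0_norm; lra.
have xc : x < c.
  rewrite ltNge; apply/negP => cx; move: far; rewrite ger0_norm ?subr_ge0 //; lra.
move: far; rewrite ltr0_norm ?subr_lt0 // => far.
apply: (concl (c - x) x ((3 * x + y) / 4)) => //; try lra.
  by rewrite ler_norml; lra.
by move=> w hw; rewrite ler0_norm; lra.
Qed.

(** Up to constants, the left increment is (lam D)^s and the right one D^s; since s > 1, a small lam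
    gains the factor lam^(s - 1) over the linear rate. *)
Lemma power_law_flat eta : 0 < eta -> exists2 lam0, 0 < lam0 &
  forall lam, 0 < lam -> lam <= lam0 -> forall D, 0 < D <= 1 ->
    F c - F (c - lam * D) <= eta * lam * (F c - F (c - D)).
Proof.
move=> eta0.
(* [D] may exceed [rho], so the increment over [c - D, c] is bounded below on [c - 2 a D, c - a D],
   where the power law holds. *)
pose a := Num.min (rho / 4) (4^-1).
have a0 : 0 < a by rewrite lt_min divr_gt0 //= invr_gt0.
have a1 : a <= rho / 4 by rewrite /a ge_min lexx.
have a2 : a <= 4^-1 by rewrite /a ge_min lexx orbT.
pose eps := eta * al * a `^ (s - 1) * a / be.
have eps0 : 0 < eps by rewrite /eps divr_gt0 // !mulr_gt0 // powR_gt0.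
have sm0 : 0 < s - 1 by rewrite subr_gt0.
pose e2 := eps `^ (s - 1)^-1.
have e20 : 0 < e2 by rewrite powR_gt0.
exists (Num.min a e2); first by rewrite lt_min a0.
move=> lam lam0; rewrite le_min => /andP[lama lame] D /andP[D0 D1].
have lD0 : 0 < lam * D by rewrite mulr_gt0.
have lDa : lam * D <= a by rewrite (le_trans _ lama) // ler_piMr // ltW.
have aD0 : 0 < a * D by rewrite mulr_gt0.
have aD1 : a * D <= a by rewrite ler_piMr // ltW.
have aD2 : a * D <= D / 4 by rewrite mulrC ler_wpM2l // ltW.
have lampow : lam `^ (s - 1) <= eps.
  have -> : eps = e2 `^ (s - 1).
    by rewrite /e2 -powRrM mulVf ?gt_eqF // powRr1 // ltW.
  by apply: pow_le => //; exact: ltW.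
have up : F c - F (c - lam * D) <= be * (lam * D) `^ (s - 1) * (lam * D).
  have [t ht ->] := @mean_value R F f1 (c - lam * D) c (fun s _ => F1 s).
  have -> : c - (c - lam * D) = lam * D by ring.
  have ht' : `|t - c| <= lam * D by rewrite ler_norml; case: ht; lra.
  by apply: ler_wpM2r; [exact: ltW|apply: f1_le => //; lra].
have lo : al * (a * D) `^ (s - 1) * (a * D) <= F c - F (c - D).
  have h := @incr_ge (a * D) (c - 2 * (a * D)) (c - a * D) aD0.
  have {}h : al * (a * D) `^ (s - 1) * (a * D) <= F (c - a * D) - F (c - 2 * (a * D)).
    have -> : al * (a * D) `^ (s - 1) * (a * D) =
      al * (a * D) `^ (s - 1) * (c - a * D - (c - 2 * (a * D))) by ring.
    apply: h; first lra.
    by move=> t ht; rewrite ler0_norm; lra.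
  have l1 : F (c - D) <= F (c - 2 * (a * D)) by apply: Fle; lra.
  have l2 : F (c - a * D) <= F c by apply: Fle; lra.
  lra.
apply: (le_trans up); have el : 0 <= eta * lam by rewrite ltW // mulr_gt0.
apply: le_trans (ler_wpM2l el lo).
rewrite (powRM _ (ltW lam0) (ltW D0)) (powRM _ (ltW a0) (ltW D0)).
have -> : be * (lam `^ (s - 1) * D `^ (s - 1)) * (lam * D) =
  lam `^ (s - 1) * (be * D `^ (s - 1) * lam * D) by ring.
have -> : eta * lam * (al * (a `^ (s - 1) * D `^ (s - 1)) * (a * D)) =
  eps * (be * D `^ (s - 1) * lam * D) by rewrite /eps; field; rewrite gt_eqF.
by rewrite ler_wpM2r // !mulr_ge0 ?powR_ge0 // ltW.
Qed.

End PowerLaw.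

(** * Global control of the cross-ratio distortion *)

Section CriticalLift.
Variable R : realType.

Record critical_lift (F f1 f2 f3 : R -> R) (N : nat) (c : 'I_N -> R) : Prop :=
  CriticalLift {
  cl_degree : degree_one F;
  cl_der1 : forall t : R, is_derive t 1 F (f1 t);
  cl_der2 : forall t : R, is_derive t 1 f1 (f2 t);
  cl_der3 : forall t : R, is_derive t 1 f2 (f3 t);
  cl_crit : forall t, f1 t = 0 <-> exists i (m : int), t = c i + m%:~R;
  cl_local : forall i, exists rho al be s : R, [/\ 0 < rho, 0 < al < be, 1 < s &
    forall t, t <> c i -> `|t - c i| < rho ->
      al * `|t - c i| `^ (s - 1) < f1 t < be * `|t - c i| `^ (s - 1) /\
      f3 t / f1 t - 3 / 2 * (f2 t / f1 t) ^+ 2 < 0] }.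

Variables (F f1 f2 f3 : R -> R) (N : nat) (c : 'I_N -> R).
Hypothesis hF : critical_lift F f1 f2 f3 c.
Let F0 := cl_degree hF.
Let F1 := cl_der1 hF.
Let F2 := cl_der2 hF.
Let F3 := cl_der3 hF.

Let f1per t : f1 (t + 1) = f1 t.
Proof. by apply: (is_derive_periodic F1 (k := 1)); case: F0. Qed.

Let f2per t : f2 (t + 1) = f2 t.
Proof. by apply: (is_derive_periodic F2 (k := 0)) => u; rewrite addr0 f1per. Qed.

Let f3per t : f3 (t + 1) = f3 t.
Proof. by apply: (is_derive_periodic F3 (k := 0)) => u; rewrite addr0 f2per. Qed.

Let Fle x y : x <= y -> F x <= F y.
Proof. by rewrite (degree_one_le F0). Qed.

Let f1_ge0 t : 0 <= f1 t.
Proof.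
have e : F^`()%classic t = f1 t by rewrite derive1E; exact: derive_val.
rewrite -e; apply: (@incr_derive1_ge0 _ F setT) => //.
- by move=> x _; have := F1 x; case.
- by move=> x y _ _; rewrite (degree_one_lt F0).
- by rewrite interiorT.
Qed.

Let f1_cont : continuous f1. Proof. exact: is_derive1_continuous F2. Qed.

Lemma critical_lift_near : exists r C : R, [/\ 0 < r, 0 < C &
  forall i (m : int) (x y : R), c i + m%:~R - r < x -> x < y -> y < c i + m%:~R + r ->
   (forall t, x <= t <= y -> f1 t * (y - x) <= C * (F y - F x)) /\
   ((forall t, x <= t <= y -> f1 t <> 0) ->
     forall t, x <= t <= y -> f3 t / f1 t - 3 / 2 * (f2 t / f1 t) ^+ 2 < 0)].
Proof.
(* A single parameter serves as radius [e] and as constant [e^-1]; both weaken when [e] decreases,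
   so a minimum over the critical points gives both. *)
pose Q i (e : R) := forall (m : int) (x y : R), c i + m%:~R - e < x -> x < y -> y < c i + m%:~R
  + e ->
   (forall t, x <= t <= y -> f1 t * (y - x) <= e^-1 * (F y - F x)) /\
   ((forall t, x <= t <= y -> f1 t <> 0) ->
     forall t, x <= t <= y -> f3 t / f1 t - 3 / 2 * (f2 t / f1 t) ^+ 2 < 0).
have [i e e' e'0 e'e Qe m x y h1 h2 h3|i|e e0 he] := @fin_uniform_pos R 'I_N Q.
- have [||k1 k2] := Qe m x y _ h2; try lra.
  split=> // t ht; apply: (le_trans (k1 t ht)).
  rewrite ler_wpM2r ?subr_ge0 ?Fle ?(ltW h2) // lef_pV2 // posrE.
  exact: lt_le_trans e'e.
- have [rho [al [be [s [rho0 /andP[al0 albe] s1 hloc]]]]] := cl_local hF i.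
  have be0 : 0 < be := lt_trans al0 albe.
  have hpow t : t <> c i -> `|t - c i| < rho ->
      al * `|t - c i| `^ (s - 1) < f1 t < be * `|t - c i| `^ (s - 1).
    by move=> h1 h2; have [] := hloc t h1 h2.
  have f1c : f1 (c i) = 0 by apply/(cl_crit hF); exists i, 0; rewrite addr0.
  have [C C0 hC] := power_law_slope F1 Fle al0 be0 s1 f1c hpow.
  have Ci : 0 < C^-1 by rewrite invr_gt0.
  exists (Num.min rho C^-1); first by rewrite lt_min rho0.
  move=> m x y h1 h2 h3.
  have l1 : Num.min rho C^-1 <= rho by rewrite ge_min lexx.
  have l2 : C <= (Num.min rho C^-1)^-1.
    by rewrite -[leLHS]invrK lef_pV2 ?posrE // ?lt_min ?rho0 // ge_min lexx orbT.
  have sh (u : R) : u = u - m%:~R + m%:~R by rewrite subrK.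
  have f1s u : f1 u = f1 (u - m%:~R) by rewrite [in LHS](sh u) (periodic_shift f1per).
  have Fs u : F u = F (u - m%:~R) + m%:~R.
    by rewrite [in LHS](sh u) (degree_one_int F0).
  split=> [t ht|hn t ht].
    have := hC (x - m%:~R) (y - m%:~R) (t - m%:~R).
    have -> : y - m%:~R - (x - m%:~R) = y - x by ring.
    rewrite -f1s.
    have -> : F (y - m%:~R) - F (x - m%:~R) = F y - F x by rewrite (Fs x) (Fs y); ring.
    move=> hh; apply: (le_trans (hh _ _ _ _)); try lra.
    by rewrite ler_wpM2r // subr_ge0 Fle // ltW.
  have tc : t - m%:~R <> c i.
    move=> e; apply: (hn t ht); apply/(cl_crit hF); exists i, m.
    by rewrite -e subrK.
  have [|_] := hloc _ tc; first by rewrite ltr_norml; lra.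
  have f2s u : f2 u = f2 (u - m%:~R) by rewrite [in LHS](sh u) (periodic_shift f2per).
  have f3s u : f3 u = f3 (u - m%:~R) by rewrite [in LHS](sh u) (periodic_shift f3per).
  by rewrite -f1s -f2s -f3s.
- by exists e, e^-1; split; rewrite ?invr_gt0 // => i; exact: he.
Qed.

Lemma critical_lift_away del : 0 < del -> exists2 m, 0 < m &
  forall t, (forall i (n : int), del <= `|t - (c i + n%:~R)|) -> m <= f1 t.
Proof.
move=> del0.
pose U : set R := \bigcup_(k : 'I_N * int) ball (c k.1 + k.2%:~R) del.
have oU : open U by apply: bigcup_open => k _; exact: ball_open.
pose A : set R := ~` U `&` `[0, 1].
have cA : compact A.
  apply: (@subclosed_compact _ A `[0, 1]) => //.
  - by apply: closedI; [exact: open_closedC|exact: interval_closed].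
  - exact: segment_compact.
  - by move=> x [].
have inA t : (forall i (n : int), del <= `|t - (c i + n%:~R)|) ->
    A (t - (Num.floor t)%:~R).
  move=> h; split.
    move=> [[i n] _] /=; rewrite -ball_normE /ball_ /= distrC.
    have := h i (n + Num.floor t); rewrite rmorphD /=.
    have -> : t - (c i + (n%:~R + (Num.floor t)%:~R)) = t - (Num.floor t)%:~R - (c i + n%:~R)
      by ring.
    lra.
  rewrite /= in_itv /=.
  by have := floor_le t; have := floorD1_gt t; rewrite rmorphD /=; lra.
have [[t0 At0]|A0] := pselect (A !=set0); last first.
  exists 1 => // t /inA h; exfalso; apply: A0; by exists (t - (Num.floor t)%:~R).
have [z zA hz] := @compact_EVT_min _ R f1 A (ex_intro _ t0 At0) cA (continuous_subspaceT f1_cont).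
exists (f1 z).
  rewrite lt_neqAle f1_ge0 andbT; apply/eqP => /esym/(cl_crit hF)[i [m e]].
  move: zA; rewrite inE => -[+ _]; apply; exists (i, m) => //=.
  by rewrite e; exact: ballxx.
move=> t /inA h; rewrite -(periodic_shift f1per (- Num.floor t) t) mulrNz.
by apply: hz; rewrite inE.
Qed.

(** The increment over length [del] has a positive minimum by periodicity. Stacking n copies with n
    the integer part of (y - x) / del costs a factor 2, because n + 1 <= 2 n. *)
Lemma critical_lift_long del : 0 < del -> exists2 m, 0 < m &
  forall x y, x + del <= y -> m * (y - x) <= F y - F x.
Proof.
move=> del0; pose g x := F (x + del) - F x.
have gc : continuous g.
  have Fc : continuous F by case: F0.
  move=> x; apply: cvgB; last exact: Fc.
  apply: (@continuous_comp _ _ _ (fun x => x + del) F); last exact: Fc.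
  by apply: cvgD; [exact: cvg_id|exact: cvg_cst].
have gp t : g (t + 1) = g t.
  by case: F0 => _ h _; rewrite /g addrAC !h; ring.
have [z hz] := periodic_argmin gc gp.
have gz : 0 < g z by rewrite subr_gt0 (degree_one_lt F0); lra.
exists (g z / (2 * del)); first by rewrite divr_gt0 // mulr_gt0.
move=> x y xy.
have step (n : nat) : n%:R * g z <= F (x + n%:R * del) - F x.
  elim: n => [|n IH]; first by rewrite !mul0r addr0 subrr.
  have := hz (x + n%:R * del); rewrite /g -addrA -natr1.
  have -> : n%:R * del + del = (n%:R + 1) * del by ring.
  by move: IH; rewrite /g; lra.
pose n := Num.truncn ((y - x) / del).
have q1 : 1 <= (y - x) / del by rewrite ler_pdivlMr //; lra.
have /andP[n1 n2] := @truncn_itv R ((y - x) / del) ltac:(lra).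
rewrite -/n in n1 n2.
have n0 : (0 < n)%N by rewrite /n truncn_gt0.
have n1' : x + n%:R * del <= y by move: n1; rewrite ler_pdivlMr //; lra.
apply: (le_trans _ (lerD (Fle n1') (lexx (- F x)))).
apply: le_trans (step n).
have -> : g z / (2 * del) * (y - x) = (y - x) / del / 2 * g z by field; rewrite gt_eqF.
rewrite ler_wpM2r ?(ltW gz) //.
have : 1 <= n%:R :> R by rewrite ler1n.
move: n2; rewrite -natr1; set Y := (y - x) / del; lra.
Qed.

Lemma near_or_away r x y : 0 < r -> y - x < r / 2 ->
  (exists i (m : int), c i + m%:~R - r < x /\ y < c i + m%:~R + r) \/
  (forall t, x <= t <= y -> forall i (m : int), r / 2 <= `|t - (c i + m%:~R)|).
Proof.
move=> r0 yx.
have [[t [ht [i [m h]]]]|h] :=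
  pselect (exists t, x <= t <= y /\ exists i (m : int), `|t - (c i + m%:~R)| < r / 2).
  by left; exists i, m; move: h; rewrite ltr_norml; lra.
right=> t ht i m; rewrite leNgt; apply/negP => h'; apply: h.
by exists t; split=> //; exists i, m.
Qed.

(** This bounds the distortion of every configuration, even one around a critical point: the
    derivative never exceeds a fixed multiple of the mean slope of an interval containing the
    point. *)
Lemma critical_lift_slope : exists2 C, 1 <= C & forall x y t, x < y -> x <= t <= y ->
  f1 t * (y - x) <= C * (F y - F x).
Proof.
have [r [C [r0 C0 hnear]]] := critical_lift_near.
have r2 : 0 < r / 2 by rewrite divr_gt0.
have [m m0 haway] := critical_lift_away r2.
have [l l0 hlong] := critical_lift_long r2.
have [M M0 hM] := periodic_bounded f1_cont f1per.
exists (1 + C + M / m + M / l).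
  by have := divr_gt0 M0 m0; have := divr_gt0 M0 l0; lra.
move=> x y t xy ht.
have Fxy : 0 <= F y - F x by rewrite subr_ge0 Fle // ltW.
have q1 : 0 <= M / m * (F y - F x) by rewrite mulr_ge0 // divr_ge0 // ltW.
have q2 : 0 <= M / l * (F y - F x) by rewrite mulr_ge0 // divr_ge0 // ltW.
have q3 : 0 <= C * (F y - F x) by rewrite mulr_ge0 // ltW.
have ftM : f1 t <= M := le_trans (ler_norm _) (hM t).
have bnd k : 0 < k -> k * (y - x) <= F y - F x -> f1 t * (y - x) <= M / k * (F y - F x).
  move=> k0 h; apply: (@le_trans _ _ (M * (y - x))).
    by rewrite ler_wpM2r // subr_ge0 ltW.
  by rewrite -mulrA ler_wpM2l ?(ltW M0) // mulrC ler_pdivlMr // mulrC.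
rewrite !mulrDl mul1r.
have [long|short] := leP (x + r / 2) y.
  by have := bnd _ l0 (hlong _ _ long); lra.
have [|[i [n [h1 h2]]]|far] := @near_or_away r x y r0; first lra.
  by have [/(_ t ht)] := hnear i n x y h1 xy h2; lra.
have : m * (y - x) <= F y - F x.
  have [xi hxi ->] := @mean_value R F f1 x y (fun s _ => F1 s).
  by rewrite ler_wpM2r ?subr_ge0 ?(ltW xy) // haway // => i n; apply: far; case: hxi; lra.
by move/(bnd _ m0); lra.
Qed.

(** The distortion is a product of two quotients of mean slopes, that of [a, b] by that of [a, d]
    and that of [d, e] by that of [b, e]. *)
Lemma cross_ratio_le_slopes k a b d e : 0 <= k -> a < b -> b < d -> d < e ->
  (F b - F a) * (d - a) <= k * (F d - F a) * (b - a) ->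
  (F e - F d) * (e - b) <= k * (F e - F b) * (e - d) ->
  cross_ratio (F a) (F b) (F d) (F e) <= k ^+ 2 * cross_ratio a b d e.
Proof.
move=> k0 ab bd de h1 h2.
have Flt u v : u < v -> 0 < F v - F u by rewrite subr_gt0 (degree_one_lt F0).
have p1 := Flt _ _ ab; have p2 := Flt _ _ de.
have p3 := Flt _ _ (lt_trans ab bd); have p4 := Flt _ _ (lt_trans bd de).
rewrite /cross_ratio ler_pdivrMr ?mulr_gt0 //.
have -> : k ^+ 2 * ((b - a) * (e - d) / ((d - a) * (e - b))) * ((F d - F a) * (F e - F b))
  = k ^+ 2 * ((b - a) * (e - d)) * ((F d - F a) * (F e - F b)) / ((d - a) * (e - b)).
  by ring.
rewrite ler_pdivlMr; last by rewrite mulr_gt0 //; lra.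
have -> : (F b - F a) * (F e - F d) * ((d - a) * (e - b)) =
  ((F b - F a) * (d - a)) * ((F e - F d) * (e - b)) by ring.
have -> : k ^+ 2 * ((b - a) * (e - d)) * ((F d - F a) * (F e - F b)) =
  (k * (F d - F a) * (b - a)) * (k * (F e - F b) * (e - d)) by ring.
by apply: ler_pM => //; apply: mulr_ge0; lra.
Qed.

(** At each lift of a critical point the floor jumps on arrival and the ceiling on departure, so a
    critical point at either end of a closed interval is detected. *)
Definition crossings (t : R) : R :=
  \sum_(i < N) (Num.floor (t - c i) + Num.ceil (t - c i))%:~R.

Lemma crossings_le x y : x <= y -> crossings x <= crossings y.
Proof.
move=> xy; apply: ler_sum => i _; rewrite ler_int.
by apply: lerD; [apply: le_floor|apply: le_ceil]; lra.
Qed.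

Lemma crossings_per t : crossings (t + 1) = crossings t + (2 * N)%:R.
Proof.
have -> : (2 * N)%:R = \sum_(i < N) 2 :> R.
  by rewrite sumr_const card_ord natrM mulr_natr.
rewrite /crossings -big_split /=; apply: eq_bigr => i _.
have -> : t + 1 - c i = (t - c i) + 1 by ring.
have -> : Num.floor (t - c i + 1) = Num.floor (t - c i) + 1.
  apply: floor_def; rewrite !rmorphD /=.
  by have := floor_itv (t - c i); rewrite rmorphD /=; lra.
have -> : Num.ceil (t - c i + 1) = Num.ceil (t - c i) + 1.
  apply: ceil_def; rewrite addrK rmorphD /=.
  by have := ceil_itv (t - c i); rewrite rmorphB /=; lra.
by rewrite !rmorphD /=; ring.
Qed.

Lemma crossings_lt x y i (m : int) : x < y -> x <= c i + m%:~R <= y ->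
  crossings x + 1 <= crossings y.
Proof.
move=> xy /andP[h1 h2].
rewrite /crossings (bigD1 i) // [leRHS](bigD1 i) //= addrAC.
have hfl k : Num.floor (x - c k) <= Num.floor (y - c k) by apply: le_floor; lra.
have hce k : Num.ceil (x - c k) <= Num.ceil (y - c k) by apply: le_ceil; lra.
apply: lerD; last first.
  by apply: ler_sum => k _; rewrite ler_int; apply: lerD.
suff : Num.floor (x - c i) + Num.ceil (x - c i) + 1 <= Num.floor (y - c i) + Num.ceil (y - c i).
  by rewrite -(ler_int R) [X in X <= _]rmorphD.
have [e|ne] := eqVneq x (c i + m%:~R).
  have : Num.ceil (x - c i) <= m by rewrite ceil_le_int; lra.
  have : m < Num.ceil (y - c i) by rewrite ceil_gt_int; lra.
  by have := hfl i; lia.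
have : m <= Num.floor (y - c i) by rewrite floor_ge_int; lra.
have : Num.floor (x - c i) < m.
  rewrite floor_lt_int; have : x < c i + m%:~R by rewrite lt_neqAle ne.
  lra.
by have := hce i; lia.
Qed.

Theorem critical_lift_cr_control : exists Phi V, cr_control F Phi V.
Proof.
have [r [C' [r0 _ hnear]]] := critical_lift_near.
have r2 : 0 < r / 2 by rewrite divr_gt0.
have [m m0 haway] := critical_lift_away r2.
have [C C1 hC] := critical_lift_slope.
have f2c : continuous f2 := is_derive1_continuous F3.
have [M M0 hM] := periodic_bounded f2c f2per.
pose K := 2 * ln C.
have K0 : 0 <= K by rewrite mulr_ge0 // ln_ge0.
have CK : C ^+ 2 = expR K.
  by rewrite /K expRM_natl lnK // posrE; lra.
pose ka := M / m.
have ka0 : 0 < ka by rewrite divr_gt0.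
(* The crude bound [C ^+ 2 = expR K] is paid by the length when it is at least r / 2, and by a jump
   of [crossings] when a critical point is present; [2 * ka] pays for the variation of [f1] far from
   the critical points. *)
pose Phi t := (2 * ka + K / (r / 2)) * t + K * crossings t.
have Kr : 0 <= K / (r / 2) by rewrite divr_ge0 // ltW.
exists Phi, (2 * ka + K / (r / 2) + K * (2 * N)%:R); split.
- move=> x y xy; apply: lerD; first by rewrite ler_wpM2l //; lra.
  by rewrite ler_wpM2l // crossings_le.
- by move=> t; rewrite /Phi crossings_per; ring.
move=> a b d e ab bd de.
have ae : a < e by lra.
have PhiE : Phi e - Phi a = 2 * ka * (e - a) + K / (r / 2) * (e - a) +
    K * (crossings e - crossings a) by rewrite /Phi; ring.
have ea : 0 <= e - a by lra.
have p1 : 0 <= 2 * ka * (e - a).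
  by apply: mulr_ge0 => //; lra.
have p2 : 0 <= K / (r / 2) * (e - a) by exact: mulr_ge0.
have p3 : 0 <= K * (crossings e - crossings a).
  by rewrite mulr_ge0 // subr_ge0 crossings_le // ltW.
have cr0 : 0 <= cross_ratio a b d e.
  by rewrite /cross_ratio divr_ge0 // mulr_ge0 //; lra.
have gen : K <= Phi e - Phi a ->
    cross_ratio (F a) (F b) (F d) (F e) <= expR (Phi e - Phi a) * cross_ratio a b d e.
  move=> h; apply: (@le_trans _ _ (C ^+ 2 * cross_ratio a b d e)); last first.
    by rewrite CK ler_wpM2r // ler_expR.
  apply: cross_ratio_le_slopes => //; first by lra.
    have [xi hxi ->] := @mean_value R F f1 a b (fun s _ => F1 s).
    have := @hC a d xi ltac:(lra) ltac:(case: hxi; lra).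
    rewrite -(ler_pM2r (_ : 0 < b - a)); last by lra.
    by apply: le_trans; rewrite mulrAC.
  have [xi hxi ->] := @mean_value R F f1 d e (fun s _ => F1 s).
  have := @hC b e xi ltac:(lra) ltac:(case: hxi; lra).
  rewrite -(ler_pM2r (_ : 0 < e - d)); last by lra.
  by apply: le_trans; rewrite mulrAC.
have [long|short] := leP (r / 2) (e - a).
  apply: gen; rewrite PhiE.
  have : K <= K / (r / 2) * (e - a).
    by rewrite mulrAC ler_pdivlMr // ler_wpM2l.
  lra.
have [[i [n hn]]|nocrit] := pselect (exists i (n : int), a <= c i + n%:~R <= e).
  apply: gen; rewrite PhiE.
  have : K <= K * (crossings e - crossings a).
    by rewrite ler_peMr //; have := crossings_lt ae hn; lra.
  lra.
have f1n t : a <= t <= e -> f1 t <> 0.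
  by move=> ht /(cl_crit hF)[i [n tn]]; apply: nocrit; exists i, n; rewrite -tn.
have [[i [n [h1 h2]]]|far] := near_or_away r0 short.
  have [_ /(_ f1n) hS] := hnear i n a e h1 ae h2.
  have f1p t : a <= t <= e -> 0 < f1 t.
    by move=> /f1n /eqP h; rewrite lt_neqAle eq_sym h f1_ge0.
  apply: (le_trans (neg_schwarzian_cross_ratio F1 F2 F3 f1p hS ab bd de)).
  by rewrite ler_peMl // -expR0 ler_expR PhiE; lra.
have fm t : a <= t <= e -> m <= f1 t by move=> ht; apply: haway; exact: far.
pose k := 1 + ka * (e - a).
have k0 : 0 < k by rewrite ltr_pwDl // mulr_ge0 ?ltW // subr_gt0.
have hk s t : a <= s <= e -> a <= t <= e -> f1 s <= k * f1 t.
  move=> hs ht; have [z hz e1] := @mean_value R f1 f2 t s (fun s _ => F2 s).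
  have h1 : f2 z * (s - t) <= M * (e - a).
    apply: (le_trans (ler_norm _)); rewrite normrM ler_pM // ler_norml; lra.
  have h2 : M * (e - a) <= ka * (e - a) * f1 t.
    have -> : M = ka * m by rewrite /ka divfK ?gt_eqF.
    by rewrite mulrAC ler_wpM2l ?fm // mulr_ge0 ?subr_ge0 ?(ltW ae) ?(ltW ka0).
  by rewrite /k mulrDl mul1r; lra.
apply: (@le_trans _ _ (k ^+ 2 * cross_ratio a b d e)); last first.
  rewrite ler_wpM2r //; apply: (@le_trans _ _ (expR (ka * (e - a)) ^+ 2)).
    by rewrite ler_pXn2r // ?nnegrE ?expR_ge0 ?(ltW k0) // expR_ge1Dx.
  by rewrite -expRM_natl ler_expR PhiE; lra.
have sl u v w z : a <= u -> u < v -> v <= e -> a <= w -> w < z -> z <= e ->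
   (F v - F u) * (z - w) <= k * (F z - F w) * (v - u).
  move=> *; have [xi hxi ->] := @mean_value R F f1 u v (fun s _ => F1 s).
  have [et het ->] := @mean_value R F f1 w z (fun s _ => F1 s).
  have := @hk xi et ltac:(case: hxi; lra) ltac:(case: het; lra).
  have q : 0 <= (v - u) * (z - w) by rewrite mulr_ge0; lra.
  by move=> /(ler_wpM2r q); lra.
apply: cross_ratio_le_slopes => //; first exact: ltW.
  by apply: sl; lra.
by apply: sl; lra.
Qed.

Lemma critical_lift_flat eta : 0 < eta -> exists2 lam, 0 < lam < 1 &
  forall x, f1 x = 0 -> forall D, 0 < D <= 1 ->
    F x - F (x - lam * D) <= eta * lam * (F x - F (x - D)).
Proof.
move=> eta0.
pose Q (i : 'I_N) (lam0 : R) := forall lam, 0 < lam -> lam <= lam0 -> forall D, 0 < D <= 1 ->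
    F (c i) - F (c i - lam * D) <= eta * lam * (F (c i) - F (c i - D)).
have [i e e' _ e'e Qe lam l0 le'|i|e e0 he] := @fin_uniform_pos R 'I_N Q.
- by apply: Qe => //; exact: le_trans e'e.
- have [rho [al [be [s [rho0 /andP[al0 albe] s1 hloc]]]]] := cl_local hF i.
  have be0 : 0 < be := lt_trans al0 albe.
  have hpow t : t <> c i -> `|t - c i| < rho ->
      al * `|t - c i| `^ (s - 1) < f1 t < be * `|t - c i| `^ (s - 1).
    by move=> h1 h2; have [] := hloc t h1 h2.
  have f1c : f1 (c i) = 0 by apply/(cl_crit hF); exists i, 0; rewrite addr0.
  exact: power_law_flat F1 Fle al0 be0 s1 f1c rho0 hpow _ eta0.
have m0 : 0 < Num.min e (2^-1) by rewrite lt_min e0 /= invr_gt0.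
have me : Num.min e (2^-1) <= e by rewrite ge_min lexx.
have m2 : Num.min e (2^-1) <= 2^-1 by rewrite ge_min lexx orbT.
exists (Num.min e (2^-1)); first by rewrite m0 /=; lra.
move=> x /(cl_crit hF)[i [n ->]] D hD.
have sh u : F (c i + n%:~R - u) = F (c i - u) + n%:~R.
  by rewrite addrAC (degree_one_int F0).
rewrite !sh (degree_one_int F0).
have := he i _ m0 me D hD; lra.
Qed.

End CriticalLift.

(** * Rotation number and continued fraction *)

Section Mirror.
Variable R : realType.
Implicit Types (F : R -> R).

(** Conjugation by t -> -t exchanges approximations of the rotation number from above and from
    below, and preserves cross-ratios and the sign of the Schwarzian derivative. *)
Definition mirror F (t : R) : R := - F (- t).

Lemma iter_mirror F k t : iter k (mirror F) t = - iter k F (- t).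
Proof. by elim: k => [|k IH] /=; rewrite ?opprK // IH /mirror opprK. Qed.

Lemma ret_mirror F q p t : ret (mirror F) q (- p) t = - ret F q p (- t).
Proof. by rewrite /ret iter_mirror mulrNz; lra. Qed.

Lemma degree_one_mirror F : degree_one F -> degree_one (mirror F).
Proof.
move=> hF; have [h1 h2 h3] := hF; split=> [s t st|t|t]; rewrite /mirror.
- by rewrite ltrN2; apply: h1; rewrite ltrN2.
- have := h2 (- (t + 1)).
  have -> : - (t + 1) + 1 = - t by ring.
  by move=> ->; lra.
- apply: cvgN; apply: (@continuous_comp _ _ _ -%R F); last exact: h3.
  exact: opp_continuous.
Qed.

Lemma rotates_as_mirror F al : rotates_as F al -> rotates_as (mirror F) (- al).
Proof.
move=> h q p t; have [h1 h2] := h q (- p) (- t).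
rewrite -[p]opprK ret_mirror; split.
  rewrite ltrNr h2 mulrNz; apply/idP/idP; lra.
rewrite ltrNl h1 mulrNz; apply/idP/idP; lra.
Qed.

Lemma cr_control_mirror F Phi V :
  cr_control F Phi V -> cr_control (mirror F) (mirror Phi) V.
Proof.
have crN (a b c d : R) : cross_ratio (- d) (- c) (- b) (- a) = cross_ratio a b c d.
  by rewrite /cross_ratio; congr (_ / _); ring.
case=> h1 h2 h3; split=> [s t st|t|a b c d ab bc cd]; rewrite /mirror.
- by rewrite lerN2; apply: h1; rewrite lerN2.
- have := h2 (- (t + 1)).
  have -> : - (t + 1) + 1 = - t by ring.
  by move=> ->; lra.
- rewrite crN -(crN a b c d) opprK addrC.
  by apply: h3; rewrite ltrN2.
Qed.

End Mirror.

(** * Existence of the translation number *)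

Section RotationNumber.
Variable R : realType.
Variable F : R -> R.
Hypothesis hF : degree_one F.

Lemma iter_ret_ge q p t m : t <= ret F q p t -> t <= iter m (ret F q p) t.
Proof.
move=> h; elim: m => [|m IH] //=.
by apply: (le_trans h); rewrite ret_le.
Qed.

Lemma iter_ret_le q p t m : ret F q p t <= t -> iter m (ret F q p) t <= t.
Proof.
move=> h; elim: m => [|m IH] //=.
by apply: le_trans h; rewrite ret_le.
Qed.

(** Iterating the bounds floor (a n) <= a n and a m <= ceil (a m) compares F^(n m)(0) with both,
    hence every (a n - 1) / n is at most every (a m + 1) / m; the supremum of the former is
    [rho]. *)
Lemma translation_number_exists :
  exists rho : R, forall n, `|iter n F 0 - n%:R * rho| <= 1.
Proof.
pose a n := iter n F 0.
have up n m : (0 < n)%N -> m%:R * (a n - 1) <= n%:R * (a m + 1).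
  move=> n0.
  pose L := Num.floor (a n); pose K := Num.ceil (a m).
  have h1 : 0 <= iter m (ret F n L) 0.
    by apply: iter_ret_ge; rewrite /ret subr_ge0 floor_le.
  have h2 : iter n (ret F m K) 0 <= 0.
    by apply: iter_ret_le; rewrite /ret subr_le0 ceil_ge.
  move: h1 h2; rewrite !iter_ret // /ret (mulnC n m) !rmorphMn /= => h1 h2.
  rewrite -[_ *+ m]mulr_natl in h1; rewrite -[_ *+ n]mulr_natl in h2.
  have l1 := floorD1_gt (a n); have l2 := ceilB1_lt (a m).
  rewrite rmorphD /= in l1; rewrite rmorphB /= in l2.
  have m1 : m%:R * (a n - 1) <= m%:R * L%:~R by rewrite ler_wpM2l //; rewrite /L; lra.
  have n1 : n%:R * K%:~R <= n%:R * (a m + 1) by rewrite ler_wpM2l //; rewrite /K; lra.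
  apply: (le_trans m1); apply: le_trans n1; move: h1 h2; lra.
pose A := [set x | exists2 n, (0 < n)%N & x = (a n - 1) / n%:R].
have A0 : A !=set0 by exists ((a 1%N - 1) / 1); exists 1%N.
have ub m : (0 < m)%N -> ubound A ((a m + 1) / m%:R).
  move=> m0 x [n n0 ->]; rewrite ler_pdivrMr ?ltr0n // mulrAC ler_pdivlMr ?ltr0n //.
  by rewrite mulrC [leRHS]mulrC; exact: up.
have hA : has_sup A by split=> //; exists ((a 1%N + 1) / 1); exact: ub.
exists (sup A) => n; case: (posnP n) => [->|n0].
  by rewrite mul0r subr0 normr0.
have h1 : (a n - 1) / n%:R <= sup A by apply: ub_le_sup; [case: hA|exists n].
have h2 : sup A <= (a n + 1) / n%:R by apply: ge_sup => //; exact: ub.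
move: h1 h2; rewrite ler_pdivrMr ?ltr0n // ler_pdivlMr ?ltr0n // ler_norml /a => h1 h2.
rewrite mulrC; lra.
Qed.

Lemma translation_number_limit (rho : R) :
  (forall n, `|iter n F 0 - n%:R * rho| <= 1) ->
  limn (fun n => iter n F 0 / n%:R) = rho.
Proof.
move=> h; apply: cvg_lim => //.
apply/cvgrPdist_le => e e0.
near=> n.
have n0 : 0 < n%:R :> R by rewrite ltr0n; near: n; exists 1%N.
have -> : rho - iter n F 0 / n%:R = - (iter n F 0 - n%:R * rho) / n%:R.
  by field; rewrite gt_eqF.
rewrite normrM normrN [`|n%:R^-1|]ger0_norm ?invr_ge0 ?(ltW n0) //.
rewrite ler_pdivrMr //; apply: (le_trans (h n)).
rewrite mulrC -ler_pdivrMr // div1r.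
by near: n; exact: nbhs_infty_ger.
Unshelve. all: by end_near. Qed.

End RotationNumber.

Section Rotates.
Variable R : realType.
Implicit Types (F : R -> R).

Lemma continuous_neq0_gt0 (g : R -> R) : continuous g -> (forall x, g x != 0) ->
  forall x, 0 < g x -> forall y, 0 < g y.
Proof.
move=> gc gn x gx y; rewrite lt_neqAle eq_sym gn leNgt; apply/negP => gy.
have gw (u v : R) : {within `[u, v]%classic, continuous g} by exact: continuous_subspaceT.
have zero z : g z = 0 -> False by move=> e; have := gn z; rewrite e eqxx.
have [xy|yx] := leP x y.
  have [|z _ /zero//] := @IVT _ g x y 0 xy (gw _ _).
  by rewrite ge_min le_max (ltW gx) (ltW gy) orbT.
have [|z _ /zero//] := @IVT _ g y x 0 (ltW yx) (gw _ _).
by rewrite ge_min le_max (ltW gx) (ltW gy) orbT.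
Qed.

(** The displacement has a minimum e > 0, so m iterates move 0 by at least m e; the error of at most
    1 forces [e <= q%:R * rho - p%:~R], which makes the inequality strict. *)
Lemma ret_gt_translation F (rho : R) q p : degree_one F ->
  (forall n, `|iter n F 0 - n%:R * rho| <= 1) ->
  (forall t, t < ret F q p t) -> 0 < q%:R * rho - p%:~R.
Proof.
move=> hF h hgt.
have [z hz] : exists z, forall x, ret F q p z - z <= ret F q p x - x.
  apply: (@periodic_argmin _ (fun x => ret F q p x - x)) => [x|t].
    by apply: cvgB; [exact: ret_continuous|exact: cvg_id].
  by rewrite -[t + 1]/(t + 1%:~R) ret_int //; lra.
set e := ret F q p z - z in hz.
have e0 : 0 < e by rewrite subr_gt0.
have hm m : m%:R * e <= iter m (ret F q p) 0.
  elim: m => [|m IH]; first by rewrite mul0r.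
  by rewrite iterS -natr1; have := hz (iter m (ret F q p) 0); lra.
suff : e <= q%:R * rho - p%:~R by lra.
rewrite leNgt; apply/negP => lt.
set d := q%:R * rho - p%:~R in lt.
have [m hm'] : exists m, 1 < m%:R * (e - d).
  have ed : 0 < e - d by lra.
  exists (Num.truncn (e - d)^-1).+1.
  have ei : 0 <= (e - d)^-1 by rewrite invr_ge0 ltW.
  rewrite -ltr_pdivrMr // mul1r; have /andP[_] := truncn_itv ei.
  by [].
have := hm m; have := h (m * q)%N; rewrite iter_ret // /ret ler_norml.
rewrite rmorphMn /= -[_ *+ m]mulr_natl natrM => /andP[_ h1] h2.
have : m%:R * (e - d) <= 1.
  by rewrite /d; move: h1 h2; set I := iter _ _ _; lra.
lra.
Qed.

(** Without periodic points the displacement of [ret F q p] never vanishes, hence has a constant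
    sign, which the translation number detects; the negative sign is the positive one for
    [mirror F]. *)
Lemma rotates_as_translation F (rho : R) : degree_one F ->
  (forall n, `|iter n F 0 - n%:R * rho| <= 1) ->
  (forall q p t, (0 < q)%N -> ret F q p t != t) -> rotates_as F rho.
Proof.
move=> hF h hper.
have gc q p : continuous (fun x => ret F q p x - x).
  by move=> x; apply: cvgB; [exact: ret_continuous|exact: cvg_id].
have gcN q p : continuous (fun x => - (ret F q p x - x)) by move=> x; apply: cvgN; exact: gc.
move=> q p t; case: (posnP q) => [->|q0].
  by rewrite /ret /= mul0r; split; apply/idP/idP; lra.
have gn x : ret F q p x - x != 0 by rewrite subr_eq0 hper.
have gnN x : - (ret F q p x - x) != 0 by rewrite oppr_eq0.
have [h0|h0|h0] := ltgtP (ret F q p t - t) 0; last by have := gn t; rewrite h0 eqxx.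
  have h0' : 0 < - (ret F q p t - t) by rewrite oppr_gt0.
  have all := continuous_neq0_gt0 (gcN q p) gnN h0'.
  have h' n : `|iter n (mirror F) 0 - n%:R * - rho| <= 1.
    by rewrite iter_mirror oppr0 mulrN -opprD normrN.
  have := @ret_gt_translation _ _ q (- p) (degree_one_mirror hF) h'.
  rewrite mulrNz => /(_ _) d0.
  have {}d0 : 0 < q%:R * - rho - - p%:~R.
    by apply: d0 => u; rewrite ret_mirror; have := all (- u); lra.
  by split; apply/idP/idP; lra.
have all := continuous_neq0_gt0 (gc q p) gn h0.
have d0 : 0 < q%:R * rho - p%:~R.
  by apply: (ret_gt_translation hF h) => u; have := all u; lra.
by split; apply/idP/idP; lra.
Qed.

End Rotates.

(** * Convergents and best approximation *)

Section ContinuedFraction.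
Variable R : realType.

(** As the determinant is 1 or -1, (m, s) is an integral combination x (q, p) + y (q', p'). The
    condition 0 < m < q' gives x != 0 and prevents x and y from having the same sign. The errors of
    (q, p) and (q', p') having opposite signs, both terms add up in absolute value. *)
Lemma best_approximation (al : R) (q q' : nat) (p p' : int) (m : nat) (s : int) :
  (Posz q * p' - Posz q' * p) ^+ 2 = 1 ->
  q'%:R * al - p'%:~R < 0 < q%:R * al - p%:~R -> (0 < q)%N ->
  (0 < m < q')%N -> q%:R * al - p%:~R <= `|m%:R * al - s%:~R|.
Proof.
move=> det /andP[d'0 d0] q0 /andP[m0 mq].
pose D := Posz q * p' - Posz q' * p.
pose x := D * (Posz m * p' - s * Posz q'); pose y := D * (s * Posz q - Posz m * p).
have DD : D * D = 1 by rewrite -expr2.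
have em : Posz m = x * Posz q + y * Posz q'.
  rewrite -[LHS]mul1r -DD /x /y /D; ring.
have es : s = x * p + y * p'.
  rewrite -[LHS]mul1r -DD /x /y /D; ring.
have key : m%:R * al - s%:~R =
    x%:~R * (q%:R * al - p%:~R) + y%:~R * (q'%:R * al - p'%:~R).
  have -> : m%:R = (Posz m)%:~R :> R by [].
  rewrite es em !rmorphD !rmorphM /=; ring.
rewrite key; clearbody x y; move: d0 d'0; set d := _ - p%:~R; set d' := _ - p'%:~R => d0 d'0.
have prod_ge0 (u : int) (k : nat) : 0 <= u -> 0 <= u * Posz k by move=> u0; rewrite mulr_ge0.
have [x0|x0|x0] := ltgtP x 0; last first.
- exfalso; move: em; rewrite x0 mul0r add0r => em.
  have [y0|y0] := leP y 0.
    have := prod_ge0 (- y) q'; rewrite mulNr; lia.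
  have := prod_ge0 (y - 1) q'; rewrite mulrBl mul1r; lia.
- have x1 : 1 <= x%:~R :> R by rewrite -[1]/(1%:~R) ler_int; lia.
  have y0 : y <= 0.
    rewrite leNgt; apply/negP => y0.
    have := prod_ge0 (y - 1) q'; have := prod_ge0 x q; rewrite mulrBl mul1r; lia.
  have {}y0 : y%:~R <= 0 :> R by rewrite -[0]/(0%:~R) ler_int.
  rewrite ler_normr; apply/orP; left.
  have := mulr_le0 y0 (ltW d'0); have := ler_wpM2r (ltW d0) x1; lra.
- have x1 : x%:~R <= - 1 :> R by rewrite -[-1]/((-1)%:~R) ler_int; lia.
  have y0 : 0 <= y.
    rewrite leNgt; apply/negP => y0.
    by have := prod_ge0 (- y) q'; have := prod_ge0 (- x) q; rewrite !mulNr; lia.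
  have {}y0 : 0 <= y%:~R :> R by rewrite -[0]/(0%:~R) ler_int.
  rewrite ler_normr; apply/orP; right.
  have := mulr_ge0_le0 y0 (ltW d'0); have := ler_wpM2r (ltW d0) x1; lra.
Qed.

(** The expansion starts with 1 / a_0, so the convergents begin with 0 / 1 and 1 / a_0, in step with
    [return_time]. *)
Fixpoint convergent_num (a : nat -> nat) (n : nat) : int :=
  match n with
  | 0 => 0
  | n'.+1 => match n' with
             | 0 => 1
             | n''.+1 => Posz (a n') * convergent_num a n' + convergent_num a n''
             end
  end.

Variables (al : R) (q : nat -> nat).
Local Notation a := (partial_quotient al).
Hypothesis al01 : 0 < al < 1.
Hypothesis al_irr : forall (m : nat) (s : int), (0 < m)%N -> m%:R * al - s%:~R != 0.
Hypothesis q_0 : q 0%N = 1%N.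
Hypothesis q_1 : q 1%N = a 0%N.
Hypothesis q_SS : forall n, q n.+2 = (a n.+1 * q n.+1 + q n)%N.
Local Notation p := (convergent_num a).
Local Notation theta n := (iter n (@gauss_map R) al).
Definition approx_error (n : nat) : R := (q n)%:R * al - (p n)%:~R.
Local Notation del := approx_error.

Lemma inv_gauss_map (x : R) : 0 < x -> x^-1 = (Num.truncn x^-1)%:R + gauss_map x.
Proof.
move=> x0; rewrite /gauss_map /frac_part.
have xi : 0 <= x^-1 by rewrite invr_ge0 ltW.
have -> : Num.floor x^-1 = Posz (Num.truncn x^-1).
  apply: floor_def; rewrite rmorphD /=.
  have /andP[h1 h2] := truncn_itv xi; rewrite -natr1 in h2.
  by rewrite -[_%:~R]/((Num.truncn x^-1)%:R) h1.
by rewrite -[_%:~R]/((Num.truncn x^-1)%:R); lra.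
Qed.

Lemma partial_quotientE n : 0 < theta n -> (theta n)^-1 = (a n)%:R + theta n.+1.
Proof. by move=> h; rewrite iterS; exact: inv_gauss_map. Qed.

(** The claims need each other: a positive [theta] gives the recursion of the errors, and a zero
    next [theta] would make the next error vanish, against irrationality. *)
Lemma approx_error_step n :
  [/\ 0 < theta n < 1, (0 < q n)%N, (0 < q n.+1)%N, 0 < theta n.+1 < 1 &
      del n.+1 = - theta n.+1 * del n].
Proof.
have frac01 (x : R) : 0 <= gauss_map x < 1.
  rewrite /gauss_map /frac_part.
  by have := floor_itv x^-1; rewrite rmorphD /=; lra.
have a_gt0 k : 0 < theta k < 1 -> (0 < a k)%N.
  move=> /andP[h0 h1]; rewrite /partial_quotient truncn_gt0 -/(theta k).
  by rewrite -[1]invr1 lef_pV2 ?posrE // ltW.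
elim: n => [|n [t0 qn qn1 t1 IH]].
  have a0 := a_gt0 0%N al01.
  have e : del 1 = - theta 1 * del 0.
    have /andP[al0 _] := al01.
    have := @partial_quotientE 0 al0; rewrite /= => h.
    have {}h : 1 = (a 0%N)%:R * al + gauss_map al * al.
      by rewrite -mulrDl -h mulVf ?gt_eqF.
    by rewrite /del q_1 q_0 /= -[1%:~R]/(1 : R); lra.
  rewrite q_0 q_1; split => //.
  have /andP[g0 g1] := frac01 al; rewrite /= g1 andbT lt_neqAle g0 andbT.
  apply/eqP => g; have := @al_irr (q 1%N) (p 1%N).
  by rewrite q_1 a0 -q_1 -/(del 1) e /= -g oppr0 mul0r eqxx => /(_ isT).
have a1 := a_gt0 n.+1 t1.
have q2 : (0 < q n.+2)%N by rewrite q_SS addn_gt0 qn orbT.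
have e : del n.+2 = - theta n.+2 * del n.+1.
  have /andP[t10 _] := t1.
  have := partial_quotientE t10 => h.
  have {}h : del n = - (theta n.+1)^-1 * del n.+1.
    by rewrite IH; field; rewrite gt_eqF.
  have -> : del n.+2 = (a n.+1)%:R * del n.+1 + del n.
    rewrite /del q_SS natrD natrM /= rmorphD rmorphM /=.
    by rewrite -[(Posz _)%:~R]/((a n.+1)%:R); ring.
  rewrite h partial_quotientE //; ring.
split=> //.
have /andP[g0 g1] := frac01 (theta n.+1).
rewrite iterS g1 andbT lt_neqAle g0 andbT.
apply/eqP => g; have := @al_irr (q n.+2) (p n.+2) q2.
by rewrite -/(del n.+2) e iterS -g oppr0 mul0r eqxx.
Qed.

Lemma q_le_succ n : (q n <= q n.+1)%N.
Proof.
case: n => [|n].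
  by rewrite q_0; have [_ _ ->] := approx_error_step 0.
have [_ _ _ /andP[t0 t1] _] := approx_error_step n.
rewrite q_SS -[leqLHS]mul1n; apply: leq_trans (leq_addr _ _).
rewrite leq_pmul2r; last by have [] := approx_error_step n.
by rewrite /partial_quotient truncn_gt0 -[1]invr1 lef_pV2 ?posrE // ltW.
Qed.

Lemma convergent_det n : (Posz (q n) * p n.+1 - Posz (q n.+1) * p n) ^+ 2 = 1.
Proof.
elim: n => [|n IH]; first by rewrite q_0 /= mulr0 subr0.
rewrite -[RHS]IH q_SS /=; rewrite -[X in Posz (q n) * X]/(p n.+1).
by rewrite PoszD PoszM; ring.
Qed.

Lemma approx_error_sign n : 0 < (-1) ^+ n * del n < 1.
Proof.
elim: n => [|n IH].
  by rewrite mul1r /del q_0 /= mul1r subr0.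
have [_ _ _ /andP[t0 t1] ->] := approx_error_step n.
rewrite exprS; move: IH t0 t1; set t := theta n.+1; set u := _ ^+ n.
have -> : -1 * u * (- t * del n) = t * (u * del n) by ring.
move=> /andP[h1 h2] t0 t1; rewrite mulr_gt0 //=.
by apply: (lt_trans _ h2); rewrite gtr_pMl.
Qed.

End ContinuedFraction.

(** * Bounds at all scales *)

Section ScaleComparison.
Variable R : realType.
Variables (F : R -> R) (al : R) (q q' : nat) (p p' : int) (K : R).
Hypothesis hF : degree_one F.
Hypothesis hrot : rotates_as F al.
Hypothesis hq : close_returns al q p q' p'.
Local Notation G := (ret F q p).
Local Notation H := (ret F q' p').
Local Notation gap x := (G x - x).
Hypothesis K1 : 1 <= K.
Hypothesis hK : forall x, gap (G x) <= K * gap x /\ gap x <= K * gap (G x).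

Let Gle := ret_le hF q p.

(** According to the order of [x] and [y], [x, G x] lies in the gap at [y] together with the next
    one or the previous one. *)
Lemma gap_le_meet x y : x <= G y -> y <= G x -> gap x <= (1 + K) * gap y.
Proof.
move=> xy yx; have [le|lt] := leP y x.
  have : G x <= G (G y) by rewrite Gle.
  by have [] := hK y; lra.
have [w Gw] := ret_surj hF q p y.
have wx : w <= x by rewrite -Gle Gw.
have : G x <= G y by rewrite Gle ltW.
by have [_] := hK w; rewrite Gw; lra.
Qed.

(** Since w < H (G w), the interval [H x, x] lies inside the gap that ends at [x], and this gap is
    compared with the one at [y]. *)
Lemma next_gap_le_meet x y : H x <= G y -> y <= x -> x - H x <= (1 + K) * gap y.
Proof.
move=> xy yx; have [w Gw] := ret_surj hF q p x.
have wH : w < H x by rewrite -Gw; exact: next_close_ret_gt hF hrot hq _.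
have := @gap_le_meet w y; rewrite Gw => /(_ _ yx) h.
have : x - w <= (1 + K) * gap y by apply: h; lra.
lra.
Qed.

Lemma gap_le_next_meet x y : H y <= G x -> x <= y -> gap y <= K * (y - H y) ->
  gap x <= (1 + K) * (K * (K * (y - H y))).
Proof.
move=> yx xy hy; have K0 : 0 < K := lt_le_trans ltr01 K1.
have K2 : 0 < 1 + K := addr_gt0 ltr01 K0.
have [w Gw] := ret_surj hF q p y.
have wH : w < H y by rewrite -Gw; exact: next_close_ret_gt hF hrot hq _.
have := @gap_le_meet x w; rewrite Gw => /(_ xy) h.
have {}h : gap x <= (1 + K) * (y - w) by apply: h; lra.
have [_] := hK w; rewrite Gw => h'.
apply: (le_trans h); rewrite (ler_pM2l K2).
by apply: (le_trans h'); rewrite (ler_pM2l K0).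
Qed.

End ScaleComparison.

Section LiftBounds.
Variable R : realType.

Lemma critical_lift_mirror (F f1 f2 f3 : R -> R) (N : nat) (c : 'I_N -> R) :
  critical_lift F f1 f2 f3 c ->
  critical_lift (mirror F) (fun t => f1 (- t)) (fun t => - f2 (- t))
    (fun t => f3 (- t)) (fun i => - c i).
Proof.
have dN f (df : R -> R) : (forall t : R, is_derive t 1 f (df t)) ->
    forall t : R, is_derive t 1 (fun t => f (- t)) (- df (- t)).
  move=> h t; have := is_derive1_comp (g := -%R) (h (- t)) (is_derive1_opp (is_derive1_id t)).
  by move=> /is_derive_eq; apply; rewrite mulrN mulr1.
case=> h0 h1 h2 h3 hc hl; split.
- exact: degree_one_mirror.
- by move=> t; apply: is_derive_eq (is_derive1_opp (dN _ _ h1 t)) _; rewrite opprK.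
- exact: dN.
- by move=> t; apply: is_derive_eq (is_derive1_opp (dN _ _ h3 t)) _; rewrite opprK.
- move=> t; rewrite hc; split=> -[i [m e]]; exists i, (- m); rewrite mulrNz; lra.
move=> i; have [rho [be [ga [s [r0 hbe s1 h]]]]] := hl i.
exists rho, be, ga, s; split=> // t tc tr.
have -> : `|t - - c i| = `|- t - c i| by rewrite -normrN; congr `|_|; ring.
have [||h' h''] := h (- t).
- by move=> e; apply: tc; rewrite -e opprK.
- by rewrite -normrN; move: tr; congr (`|_| < _); ring.
- by split=> //; rewrite mulNr sqrrN.
Qed.

Variables (F f1 f2 f3 : R -> R) (N : nat) (c : 'I_N -> R).
Hypothesis hF : critical_lift F f1 f2 f3 c.
Hypothesis hper : forall q p t, (0 < q)%N -> ret F q p t != t.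
Variable rho : R.
Hypothesis hrho : forall n, `|iter n F 0 - n%:R * rho| <= 1.
Variable q : nat -> nat.
Local Notation al := (frac_part rho).
Local Notation a := (partial_quotient al).
Hypothesis q_0 : q 0%N = 1%N.
Hypothesis q_1 : q 1%N = a 0%N.
Hypothesis q_SS : forall n, q n.+2 = (a n.+1 * q n.+1 + q n)%N.

(** [rotation_number] is the fractional part of the translation number [rho] of the chosen lift; the
    integer part is restored in the numerators. *)
Definition return_shift n : int := convergent_num a n + Posz (q n) * Num.floor rho.
Local Notation P := return_shift.
Definition lift_ret n t : R := ret F (q n) (P n) t.
Local Notation G := lift_ret.

Let F0 := cl_degree hF.
Let hrot : rotates_as F rho. Proof. exact: rotates_as_translation. Qed.

Lemma lift_irrational (m : nat) (s : int) : (0 < m)%N -> m%:R * rho - s%:~R != 0.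
Proof.
move=> m0; have [h1 h2] := hrot m s 0; have := hper s 0 m0.
by apply: contraNneq => e; move: h1 h2; rewrite e ltxx; case: ltgtP.
Qed.

Let frac_shift (m : nat) (s : int) :
  m%:R * al - s%:~R = m%:R * rho - (s + Posz m * Num.floor rho)%:~R.
Proof. by rewrite /frac_part rmorphD rmorphM /= -[(Posz m)%:~R]/(m%:R); ring. Qed.

Let al_irr (m : nat) (s : int) : (0 < m)%N -> m%:R * al - s%:~R != 0.
Proof. by move=> m0; rewrite frac_shift lift_irrational. Qed.

Let al01 : 0 < al < 1.
Proof.
have := @al_irr 1 0 isT; rewrite mul1r subr0 /frac_part => h.
have := floor_itv rho; rewrite rmorphD /= => hf.
by rewrite lt_neqAle eq_sym h /=; lra.
Qed.

Let delta n := (q n)%:R * rho - (P n)%:~R.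

Let deltaE n : delta n = approx_error al q n.
Proof. by rewrite /approx_error frac_shift. Qed.

Let step n := approx_error_step al01 al_irr q_0 q_1 q_SS n.

Lemma q_gt0 n : (0 < q n)%N. Proof. by have [] := step n. Qed.

Let delta_sign n : 0 < (-1) ^+ n * delta n < 1.
Proof. by rewrite deltaE; exact: approx_error_sign. Qed.

Let delta_step n : exists2 th, 0 < th < 1 & delta n.+1 = - th * delta n.
Proof. by rewrite !deltaE; have [_ _ _ h ->] := step n; eexists; first exact: h. Qed.

Let best n (m : nat) (s : int) : 0 < delta n -> (0 < m < q n.+1)%N ->
  delta n <= `|m%:R * rho - s%:~R|.
Proof.
move=> d0 hm; have [th /andP[th0 _] e] := delta_step n.
have := @best_approximation R al _ _ _ _ m (s - Posz m * Num.floor rho)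
  (convergent_det q_0 q_SS n) _ (q_gt0 n) hm.
rewrite (frac_shift m) subrK.
rewrite -![_ - (convergent_num _ _)%:~R]/(approx_error al q _) -!deltaE; apply.
by rewrite d0 e mulNr oppr_lt0 mulr_gt0.
Qed.

Let best_neg n (m : nat) (s : int) : delta n < 0 -> (0 < m < q n.+1)%N ->
  - delta n <= `|m%:R * - rho - s%:~R|.
Proof.
move=> d0 hm; have [th /andP[th0 _] e] := delta_step n.
have det : (Posz (q n) * - convergent_num a n.+1 - Posz (q n.+1) * - convergent_num a n) ^+ 2 = 1.
  by rewrite -[RHS](convergent_det q_0 q_SS n); ring.
have := @best_approximation R (- al) _ _ _ _ m (s + Posz m * Num.floor rho)
  det _ (q_gt0 n) hm.
have -> : m%:R * - al - (s + Posz m * Num.floor rho)%:~R = m%:R * - rho - s%:~R.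
  by rewrite /frac_part rmorphD rmorphM /= -[(Posz m)%:~R]/(m%:R); ring.
have dE k : (q k)%:R * - al - (- convergent_num a k)%:~R = - delta k.
  by rewrite deltaE /approx_error mulrNz; ring.
rewrite !dE; apply.
by rewrite oppr_gt0 d0 andbT e mulNr opprK pmulr_rlt0.
Qed.

Let even_close n : ~~ odd n -> close_returns rho (q n) (P n) (q n.+1) (P n.+1).
Proof.
move=> ev; have := delta_sign n; rewrite -signr_odd (negbTE ev) mul1r => d01.
have [th /andP[th0 th1] e] := delta_step n.
have d0 : 0 < delta n by case/andP: d01.
split=> //.
- by rewrite q_gt0 (q_le_succ al01 al_irr q_0 q_1 q_SS).
- rewrite -/(delta n) -/(delta n.+1) e mulNr opprK mulr_gt0 //=.
  by rewrite gtr_pMl.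
- by move=> m s; exact: best.
Qed.

Let odd_close n : odd n -> close_returns (- rho) (q n) (- P n) (q n.+1) (- P n.+1).
Proof.
move=> od; have := delta_sign n; rewrite -signr_odd od mulN1r => d01.
have [th /andP[th0 th1] e] := delta_step n.
have d0 : delta n < 0 by rewrite -oppr_gt0; case/andP: d01.
have dE k : (q k)%:R * - rho - (- P k)%:~R = - delta k by rewrite /delta mulrNz; ring.
split; rewrite ?dE //.
- by rewrite q_gt0 (q_le_succ al01 al_irr q_0 q_1 q_SS).
- rewrite opprK e mulNr oppr_gt0 pmulr_rlt0 // d0 /= ltrN2.
  by rewrite -subr_gt0 -[X in _ - X]mul1r -mulrBl nmulr_lgt0 // subr_lt0.
- by move=> m s; exact: best_neg.
Qed.

Definition lift_len n t : R := `|G n t - t|.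
Local Notation len := lift_len.
Local Notation M := (mirror F).

(** The last clause decides which of the two arcs between x and f^{q_n}(x) is I_n(x). *)
Lemma even_order n t : ~~ odd n -> [/\ t < G n t, G n t < t + 1 & t < G n.+2 t < G n t].
Proof.
move=> ev; have hc := even_close ev; have ev2 : ~~ odd n.+2 by rewrite /= negbK.
split; [exact: close_ret_gt hrot hc _|exact: close_ret_lt1 F0 hrot hc _|].
rewrite (close_ret_gt hrot (even_close ev2)) /lift_ret (ret_ltE F0 hrot).
rewrite -/(delta n) -/(delta n.+2).
have [th h e] := delta_step n; have [th' h' e'] := delta_step n.+1.
rewrite e' e; have := delta_sign n; rewrite -signr_odd (negbTE ev) mul1r => /andP[d0 _].
have -> : - th' * (- th * delta n) = (th' * th) * delta n by ring.
rewrite gtr_pMl //; move: h h' => /andP[? ?] /andP[? ?].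
by apply: mulr_ilt1; rewrite // ltW.
Qed.

Lemma odd_order n t : odd n -> [/\ G n t < t, t - 1 < G n t & G n t < G n.+2 t < t].
Proof.
move=> od; have hc := odd_close od; have od2 : odd n.+2 by rewrite /= negbK.
have rM := rotates_as_mirror hrot; have dM := degree_one_mirror F0.
have GE k : G k t = - ret M (q k) (- P k) (- t) by rewrite ret_mirror !opprK.
split; rewrite ?GE.
- by have := close_ret_gt rM hc (- t); lra.
- by have := close_ret_lt1 dM rM hc (- t); lra.
rewrite [X in _ && X](_ : _ = true); last first.
  by have := close_ret_gt rM (odd_close od2) (- t); lra.
rewrite andbT ltrN2 (ret_ltE dM rM).
have dE k : (q k)%:R * - rho - (- P k)%:~R = - delta k by rewrite /delta mulrNz; ring.
rewrite !dE.
have [th h e] := delta_step n; have [th' h' e'] := delta_step n.+1.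
rewrite e' e; have := delta_sign n; rewrite -signr_odd od mulN1r => /andP[d0 _].
have -> : - (- th' * (- th * delta n)) = (th' * th) * - delta n by ring.
rewrite gtr_pMl //; move: h h' => /andP[? ?] /andP[? ?].
by apply: mulr_ilt1; rewrite // ltW.
Qed.

Lemma even_len n t : ~~ odd n -> len n t = G n t - t.
Proof. by move=> ev; have [h _ _] := even_order t ev; rewrite /len gtr0_norm // subr_gt0. Qed.

Lemma odd_len n t : odd n -> len n t = t - G n t.
Proof.
by move=> od; have [h _ _] := odd_order t od; rewrite /len ltr0_norm ?subr_lt0 // opprB.
Qed.

Let GE n t : G n t = - ret M (q n) (- P n) (- t).
Proof. by rewrite ret_mirror !opprK. Qed.

Lemma len_comparable Phi V n t : cr_control F Phi V ->
  len n (G n t) <= geometry_bound V * len n t /\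
  len n t <= geometry_bound V * len n (G n t).
Proof.
move=> hcr; have V0 := cr_control_ge0 hcr.
have [od|ev] := boolP (odd n); last first.
  rewrite !even_len //; exact: (bounded_geometry V0 F0 hrot (even_close ev) hcr t).
have := bounded_geometry V0 (degree_one_mirror F0) (rotates_as_mirror hrot)
  (odd_close od) (cr_control_mirror hcr) (- t).
rewrite !odd_len // [G n (G n t)]GE !GE !opprK.
set Y := ret M _ _ (ret _ _ _ _); set X := ret M _ _ _; set C := geometry_bound V.
by case=> h1 h2; split; lra.
Qed.

Lemma critical_len : exists2 K, 0 < K & forall n j t, f1 t = 0 -> (j <= q n)%N ->
  len n (iter j F t) <= K * len n.+1 (iter j F t).
Proof.
have [Phi [V hcr]] := critical_lift_cr_control hF.
have V0 := cr_control_ge0 hcr.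
have dM := degree_one_mirror F0; have rM := rotates_as_mirror hrot.
have cM := cr_control_mirror hcr.
have C1 := geometry_bound_ge1 V0; set C := geometry_bound V in C1.
have B1 := distortion_ge1 V0; set B := distortion V in B1.
have B0 : 0 < B := lt_le_trans ltr01 B1.
have C0 : 0 < C := lt_le_trans ltr01 C1.
have fl0 : 0 < flatness V.
  rewrite invr_gt0; apply: mulr_gt0; first exact: mulr_gt0.
  by apply: exprn_gt0; exact: addr_gt0.
have [l1 l101 hl1] := critical_lift_flat hF fl0.
have [l2 l201 hl2] := critical_lift_flat (critical_lift_mirror hF) fl0.
pose k l := C * (1 + B * (1 + C) * (1 + (C + C ^+ 2 + C ^+ 3) * (2 * C / l) * C)).
have k0 l : 0 < l -> 0 < k l.
  move=> l0; apply: mulr_gt0 => //; apply: addr_gt0 => //; apply: mulr_gt0.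
    by apply: mulr_gt0 => //; exact: addr_gt0.
  apply: addr_gt0 => //; apply: mulr_gt0 => //; apply: mulr_gt0.
    by rewrite !addr_gt0 // exprn_gt0.
  by apply: divr_gt0 => //; exact: mulr_gt0.
have l10 : 0 < l1 by case/andP: l101.
have l20 : 0 < l2 by case/andP: l201.
(* Flatness is used on the left of [t] at even scales and on its right at odd ones, with ratios [l1]
   and [l2]. *)
exists (k l1 + k l2); first by rewrite addr_gt0 ?k0.
move=> n j t ft jq.
have lenge0 m x : 0 <= len m x by exact: normr_ge0.
suff [] : len n (iter j F t) <= k l1 * len n.+1 (iter j F t) \/
          len n (iter j F t) <= k l2 * len n.+1 (iter j F t).
- move=> h; apply: (le_trans h); rewrite ler_wpM2r // lerDl ltW ?k0 //.
- move=> h; apply: (le_trans h); rewrite ler_wpM2r // lerDr ltW ?k0 //.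
have [od|ev] := boolP (odd n); [right|left].
  have ev : ~~ odd n.+1 by rewrite /= negbK.
  have ft' : f1 (- - t) = 0 by rewrite opprK.
  have eM : iter j M (- t) = - iter j F t by rewrite iter_mirror opprK.
  have [_ hH] := len_comparable n.+1 t hcr; rewrite !even_len // in hH.
  have hH' : - t - ret M (q n.+1) (- P n.+1) (- t) <=
      C * (ret M (q n.+1) (- P n.+1) (- t) -
           ret M (q n.+1) (- P n.+1) (ret M (q n.+1) (- P n.+1) (- t))).
    by move: hH; rewrite !GE !opprK /C; set X := ret _ _ _ _; lra.
  have hg := critical_gap V0 dM rM (odd_close od) cM l201 (hl2 (- t) ft').
  have := orbit_gap V0 dM rM (odd_close od) cM jq _ hg hH'.
  rewrite eM (odd_len _ od) (even_len _ ev) !GE => h; rewrite /k.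
  have := h (divr_gt0 (mulr_gt0 (ltr0Sn R 1) C0) l20); rewrite -/C -/B; lra.
have od : odd n.+1 by [].
have [_ hH] := len_comparable n.+1 t hcr; rewrite !odd_len // in hH.
have hg := critical_gap V0 F0 hrot (even_close ev) hcr l101 (hl1 t ft).
have := orbit_gap V0 F0 hrot (even_close ev) hcr jq _ hg hH.
rewrite (even_len _ ev) (odd_len _ od) => h; apply: h.
exact: divr_gt0 (mulr_gt0 (ltr0Sn R 1) C0) l10.
Qed.

(* For [t] over x, I_n(x) lifts to the interval from [lift_lo n t] to [lift_hi n t]. *)
Definition lift_lo n t : R := Num.min t (G n t).
Definition lift_hi n t : R := Num.max t (G n t).
Local Notation lo := lift_lo.
Local Notation hi := lift_hi.

Lemma even_lo n t : ~~ odd n -> lo n t = t /\ hi n t = G n t.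
Proof.
by move=> ev; have [/ltW h _ _] := even_order t ev; rewrite /lo /hi min_l ?max_r.
Qed.

Lemma odd_lo n t : odd n -> lo n t = G n t /\ hi n t = t.
Proof.
by move=> od; have [/ltW h _ _] := odd_order t od; rewrite /lo /hi min_r ?max_l.
Qed.

Definition lift_meet m s n t : Prop := lo m s <= hi n t /\ lo n t <= hi m s.

(** Only the third clause, a gap of level n bounded by one of level n+1 that it meets, needs a
    critical orbit. The integer [m] accounts for the choice of lifts of two meeting atoms. *)
Theorem lift_bounds : exists2 K, 0 < K & forall n,
  [/\ forall s t, lift_meet n s n t -> len n s <= K * len n t,
      forall s t, lift_meet n.+1 s n t -> len n.+1 s <= K * len n t &
      forall s t j (m : int), (j <= q n)%N -> f1 t = 0 ->
        lift_meet n s n.+1 (iter j F t + m%:~R) ->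
        len n s <= K * len n.+1 (iter j F t + m%:~R)].
Proof.
have [Phi [V hcr]] := critical_lift_cr_control hF.
have C1 := geometry_bound_ge1 (cr_control_ge0 hcr); set C := geometry_bound V in C1.
have [D D0 hD] := critical_len.
have dM := degree_one_mirror F0; have rM := rotates_as_mirror hrot.
pose K := C + D; have K1 : 1 <= K by rewrite /K; lra.
have K0 : 0 < K := lt_le_trans ltr01 K1.
have len0 n t : 0 <= len n t by exact: normr_ge0.
have len_int n t (m : int) : len n (t + m%:~R) = len n t.
  by rewrite /lift_len /lift_ret ret_int // opprD addrACA subrr addr0.
have hK n t : len n (G n t) <= K * len n t /\ len n t <= K * len n (G n t).
  have [h1 h2] := len_comparable n t hcr; rewrite -/C in h1 h2.
  have := mulr_ge0 (ltW D0) (len0 n t); have := mulr_ge0 (ltW D0) (len0 n (G n t)).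
  by rewrite /K !mulrDl; lra.
have hc n j t : f1 t = 0 -> (j <= q n)%N -> len n (iter j F t) <= K * len n.+1 (iter j F t).
  move=> ft jq; apply: (le_trans (hD n j t ft jq)); rewrite ler_wpM2r // /K; lra.
have K2 : 0 < 1 + K := addr_gt0 ltr01 K0.
have KK : 1 <= K * K by apply: mulr_ege1.
exists ((1 + K) * (K * K)); first by rewrite !mulr_gt0.
have weak x y : 0 <= y -> x <= (1 + K) * y -> x <= (1 + K) * (K * K) * y.
  by move=> y0 /le_trans; apply; rewrite ler_wpM2r // ler_peMr // ltW.
move=> n; have [od|ev] := boolP (odd n); last first.
- have od1 : odd n.+1 by [].
  have cl := even_close ev.
  have hK' t : G n (G n t) - G n t <= K * (G n t - t) /\ G n t - t <= K * (G n (G n t) - G n t).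
    by have := hK n t; rewrite !even_len.
  have E t : (lo n t = t) * (hi n t = G n t) by split; case: (even_lo t ev).
  have O t : (lo n.+1 t = G n.+1 t) * (hi n.+1 t = t) by split; case: (odd_lo t od1).
  rewrite /lift_meet; split=> [s t|s t|s t j m jq ft]; rewrite !(E, O).
  + move=> [h1 h2]; apply: weak => //; rewrite !even_len //.
    exact: (gap_le_meet F0 hK' h1 h2).
  + move=> [h1 h2]; apply: weak => //; rewrite (even_len _ ev) (odd_len _ od1).
    exact: (next_gap_le_meet F0 hrot cl hK' h1 h2).
  + have := hc n j t ft jq; rewrite -(len_int n _ m) -(len_int n.+1 _ m).
    set y := iter j F t + _; rewrite !(even_len _ ev) (odd_len _ od1) => h [h1 h2].
    rewrite -!mulrA.
    by apply: (gap_le_next_meet F0 hrot cl K1 hK' _ _ h); [exact: h2|exact: h1].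
have ev1 : ~~ odd n.+1 by rewrite /= negbK.
have cl := odd_close od.
set g := ret M (q n) (- P n); set g' := ret M (q n.+1) (- P n.+1).
have Ge t : G n t = - g (- t) by exact: GE.
have Ge' t : G n.+1 t = - g' (- t) by exact: GE.
have hK' t : g (g t) - g t <= K * (g t - t) /\ g t - t <= K * (g (g t) - g t).
  have := hK n (- t); rewrite !odd_len // !Ge !opprK.
  by rewrite ![- _ + _]addrC.
have O t : (lo n t = G n t) * (hi n t = t) by split; case: (odd_lo t od).
have E t : (lo n.+1 t = t) * (hi n.+1 t = G n.+1 t) by split; case: (even_lo t ev1).
rewrite /lift_meet; split=> [s t|s t|s t j m jq ft]; rewrite !(E, O).
- move=> [h1 h2]; apply: weak => //; rewrite !odd_len // !Ge.
  rewrite Ge in h1; rewrite Ge in h2.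
  have i1 : - s <= g (- t) by lra.
  have i2 : - t <= g (- s) by lra.
  have := gap_le_meet dM hK' i1 i2; rewrite -/g; lra.
- move=> [h1 h2]; apply: weak => //; rewrite (even_len _ ev1) (odd_len _ od) Ge Ge'.
  rewrite Ge in h2; rewrite Ge' in h2.
  have i1 : g' (- s) <= g (- t) by lra.
  have i2 : - t <= - s by lra.
  have := next_gap_le_meet dM rM cl hK' i1 i2; rewrite -/g -/g'; lra.
have := hc n j t ft jq; rewrite -(len_int n _ m) -(len_int n.+1 _ m).
set y := iter j F t + _; rewrite !(odd_len _ od) (even_len _ ev1) !Ge Ge' => h [h1 h2].
have i1 : g' (- y) <= g (- s) by lra.
have i2 : - s <= - y by lra.
have i3 : g (- y) - - y <= K * (- y - g' (- y)) by lra.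
have := gap_le_next_meet dM rM cl K1 hK' i1 i2 i3; rewrite -/g -/g'; lra.
Qed.

End LiftBounds.

(** * Atoms of the dynamical partitions *)

Section CircleFacts.
Variable R : realType.
Implicit Types (s t u a b : R).
Local Notation proj := (@circle_proj R).

Lemma circle_proj_int t (m : int) : proj (t + m%:~R) = proj t.
Proof. by apply/circle_projP; rewrite addrAC subrr add0r intr_int. Qed.

Lemma circle_proj_eq s t : proj s = proj t -> exists m : int, s = t + m%:~R.
Proof.
by move=> /circle_projP/intrP[m e]; exists m; rewrite -e addrC subrK.
Qed.

Lemma circle_proj_repr (x : circle R) : proj (repr x) = x.
Proof. exact: reprK. Qed.

Lemma circle_proj_continuous : continuous proj.
Proof. exact: pi_continuous. Qed.

Lemma circle_dist_near s t : `|s - t| < 2^-1 -> circle_dist (proj s) (proj t) = `|s - t|.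
Proof.
move=> st; apply/eqP; rewrite eq_le; apply/andP; split.
  apply: ge_inf; last by exists s, t.
  by exists 0 => d [u [v [_ _ ->]]].
apply: lb_le_inf; first by exists `|s - t|, s, t.
move=> d [u [v [/circle_proj_eq[m ->] /circle_proj_eq[n ->] ->]]].
have -> : s + m%:~R - (t + n%:~R) = (s - t) + (m - n)%:~R by rewrite rmorphB /=; ring.
have [-> //|k0] := eqVneq (m - n) 0; first by rewrite addr0.
have k1 : 1 <= `|(m - n)%:~R| :> R.
  by rewrite -intr_norm -[1]/(1%:~R) ler_int; lia.
have := ler_normB (s - t + (m - n)%:~R) (s - t).
rewrite [X in `|X| <= _](_ : _ = (m - n)%:~R); last by ring.
lra.
Qed.

Lemma circle_arc_proj a b : a <= b -> b < a + 1 ->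
  circle_arc (proj a) (proj b) = proj @` `[a, b].
Proof.
move=> ab ba; apply/seteqP; split=> [z [s [t [u [es et <- /andP[su ut] ts]]]]|z /= [u]].
  have [m ms] := circle_proj_eq es; have [n nt] := circle_proj_eq et.
  have mn : m = n.
    have h1 : (n - m)%:~R < (1%:~R : R) by rewrite rmorphB /= -[1%:~R]/(1 : R); lra.
    have h2 : (-1)%:~R < ((n - m)%:~R : R) by rewrite rmorphB /= mulrN1z; lra.
    by move: h1 h2; rewrite !ltr_int; lia.
  exists (u - m%:~R); last by rewrite -mulrNz circle_proj_int.
  by rewrite /= in_itv /=; subst n; lra.
rewrite in_itv /= => /andP[au ub] <-.
by exists a, b, u; split=> //; rewrite au.
Qed.

Lemma circle_length_proj a b : a <= b -> b < a + 1 ->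
  circle_length (proj @` `[a, b]) = b - a.
Proof.
move=> ab ba.
pose m := Num.floor a; pose a' := a - m%:~R; pose b' := b - m%:~R.
have ha : 0 <= a' < 1.
  by rewrite /a'; have := floor_itv a; rewrite rmorphD /= -/m; lra.
have E : proj @` `[a, b] = proj @` `[a', b'].
  apply/seteqP; split=> z [u /=]; rewrite in_itv /= => hu <-.
    exists (u - m%:~R); last by rewrite -mulrNz circle_proj_int.
    by rewrite /= in_itv /= /a' /b'; lra.
  exists (u + m%:~R); last by rewrite circle_proj_int.
  by rewrite /= in_itv /=; move: hu; rewrite /a' /b'; lra.
have -> : b - a = b' - a' by rewrite /a' /b'; ring.
rewrite E; have {}ab : a' <= b' by rewrite /a' /b'; lra.
have {}ba : b' < a' + 1 by rewrite /a' /b'; lra.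
clear E; rewrite /circle_length.
have inP t : (proj @^-1` (proj @` `[a', b'])) t <->
    exists n : int, a' <= t + n%:~R <= b'.
  split=> [[u /=]|[n hn]].
    rewrite in_itv /= => hu /circle_proj_eq[n e].
    by exists n; rewrite -e.
  by exists (t + n%:~R); rewrite /= ?in_itv // circle_proj_int.
have intb (n : int) t : 0 <= t < 1 -> a' <= t + n%:~R <= b' -> n = 0 \/ n = 1.
  move=> ht hn.
  have h1 : n%:~R < (2%:~R : R) by rewrite -[2%:~R]/(2 : R); lra.
  have h2 : (-1)%:~R < (n%:~R : R) by rewrite mulrN1z; lra.
  by move: h1 h2; rewrite !ltr_int; lia.
(* If b' >= 1 the arc passes through the point 0 of the circle, and its trace on [0, 1[ has two
   pieces. *)
have [b1|b1] := ltP b' 1.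
  have -> : proj @^-1` (proj @` `[a', b']) `&` `[0, 1[%classic = `[a', b']%classic.
    apply/seteqP; split=> t.
      move=> [/inP[n hn]]; rewrite /= !in_itv /= => ht.
      have [n0|n1] := intb n t ht hn; move: hn.
        by rewrite n0 addr0.
      by rewrite n1 -[1%:~R]/(1 : R); lra.
    rewrite /= in_itv /= => ht; split; last by rewrite /= in_itv /=; lra.
    by apply/inP; exists 0; rewrite addr0.
  rewrite lebesgue_measure_itv /= lte_fin.
  have [_|h] := ltP a' b'; first by rewrite -EFinB.
  by rewrite /=; lra.
have -> : proj @^-1` (proj @` `[a', b']) `&` `[0, 1[%classic = `[a', 1[%classic `|` `[0, b' -
  1]%classic.
  apply/seteqP; split=> t.
    move=> [/inP[n hn]]; rewrite /= !in_itv /= => ht.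
    have [n0|n1] := intb n t ht hn; move: hn.
      by rewrite n0 addr0; left; lra.
    by rewrite n1 -[1%:~R]/(1 : R); right; lra.
  move=> [|]; rewrite /= in_itv /= => ht; (split; last by rewrite /= in_itv /=; lra); apply/inP.
    by exists 0; rewrite addr0; lra.
  by exists 1; rewrite -[1%:~R]/(1 : R); lra.
rewrite measureU //=; last first.
  by apply/seteqP; split=> t //= []; rewrite !in_itv /=; lra.
rewrite !lebesgue_measure_itv /= !lte_fin.
have -> : a' < 1 by case/andP: ha.
have [_|h] := ltP 0 (b' - 1); first by rewrite -!EFinB -EFinD /=; lra.
by rewrite -!EFinB adde0 /=; lra.
Qed.

End CircleFacts.

Section CircleMaps.
Variable R : realType.
Variable f : circle R -> circle R.
Local Notation proj := (@circle_proj R).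
Local Notation F := (lift_of f).

(** The chosen lift differs by a constant from the monotone one, hence is monotone. Its degree is 1:
    were it larger, F would take the value F t + 1 strictly between t and t + 1, and f would not be
    injective. *)
Lemma lift_of_spec : circle_homeomorphism f -> orientation_preserving f ->
  degree_one F /\ forall t, proj (F t) = f (proj t).
Proof.
move=> [_ [g [_ fK _]]] [F0 hF0 F0lt].
have [Fc Fp] : is_lift f F by rewrite /lift_of; case: xgetP => [y _ //|/(_ F0)].
have [F0c F0p] := hF0.
have finj : injective f by exact: can_inj fK.
pose d t := F t - F0 t.
have dint t : exists m : int, d t = m%:~R.
  have [m e] : exists m : int, F t = F0 t + m%:~R by apply: circle_proj_eq; rewrite Fp F0p.
  by exists m; rewrite /d e addrAC subrr add0r.
have dc : continuous d by move=> t; apply: cvgB; [exact: Fc|exact: F0c].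
have dconst s t : s <= t -> d s = d t.
  move=> st; have [m em] := dint s; have [n en] := dint t.
  have [//|ne] := eqVneq (d s) (d t).
  have mn : m != n by apply: contra_neq ne => mn; rewrite em en mn.
  (* A value halfway between consecutive integers, which an integer-valued function cannot take. *)
  pose v : R := (Num.min (d s) (d t)) + 2^-1.
  have [||u _ hu] := @IVT R d s t v st.
  - exact: continuous_subspaceT.
  - rewrite /v em en; have [lt|lt] := leP (m%:~R : R) n%:~R.
      have : m + 1 <= n by move: lt mn; rewrite ler_int; lia.
      by rewrite -(ler_int R) rmorphD /= => ?; apply/andP; split; lra.
    have : n + 1 <= m by move: lt; rewrite ltr_int; lia.
    by rewrite -(ler_int R) rmorphD /= => ?; apply/andP; split; lra.
  have [k ek] := dint u; rewrite hu /v in ek.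
  have [j ej] : exists j : int, Num.min (d s) (d t) = j%:~R.
    by rewrite em en; have [_|_] := leP (m%:~R : R) n%:~R; [exists m|exists n].
  rewrite ej in ek.
  have h1 : (j%:~R : R) < k%:~R by lra.
  have h2 : (k%:~R : R) < (j + 1)%:~R by rewrite rmorphD /=; lra.
  by move: h1 h2; rewrite !ltr_int; lia.
have Flt s t : s < t -> F s < F t.
  move=> st; have := dconst s t (ltW st); have := F0lt s t st; rewrite /d; lra.
have Fint t : exists m : int, F (t + 1) = F t + m%:~R.
  by apply: circle_proj_eq; rewrite !Fp -[t + 1]/(t + 1%:~R) circle_proj_int.
split=> //; split=> // t.
have [m em] := Fint t; have lt : F t < F (t + 1) by apply: Flt; lra.
have m1 : 1 <= m.
  have : (0%:~R : R) < m%:~R by rewrite -[0%:~R]/(0 : R); lra.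
  by rewrite ltr_int; lia.
have [e1|ne] := eqVneq m 1; first by rewrite em e1.
exfalso; have m2 : (2%:~R : R) <= m%:~R by rewrite ler_int; lia.
rewrite -[2%:~R]/(2 : R) in m2.
have [||u + hu] := @IVT R F t (t + 1) (F t + 1) ltac:(lra).
- exact: continuous_subspaceT.
- by rewrite em ge_min le_max; apply/andP; split; apply/orP; [left|right]; lra.
rewrite in_itv /= => /andP[tu ut].
have : proj u = proj t.
  by apply: finj; rewrite -!Fp hu -[1]/(1%:~R) circle_proj_int.
move=> /circle_proj_eq[k ek].
have tu' : t < u.
  rewrite lt_neqAle tu andbT; apply/eqP => e; move: hu; rewrite -e; lra.
have ut' : u < t + 1.
  rewrite lt_neqAle ut andbT; apply/eqP => e; move: hu; rewrite e em; lra.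
have h1 : (0%:~R : R) < k%:~R by rewrite -[0%:~R]/(0 : R); lra.
have h2 : (k%:~R : R) < 1%:~R by rewrite -[1%:~R]/(1 : R); lra.
by move: h1 h2; rewrite !ltr_int; lia.
Qed.

Hypothesis hproj : forall t, proj (F t) = f (proj t).
Hypothesis F0 : degree_one F.

Lemma iter_proj k t : iter k f (proj t) = proj (iter k F t).
Proof. by elim: k => //= k ->; rewrite hproj. Qed.

Lemma image_iter_proj k a b : iter k f @` (proj @` `[a, b]) =
  proj @` `[iter k F a, iter k F b].
Proof.
apply/seteqP; split=> [_ [_ [u /= hu <-] <-]|_ [v /= hv <-]].
  exists (iter k F u); last by rewrite iter_proj.
  by move: hu; rewrite /= !in_itv /= !iter_degree_one_le.
have [u e] := iter_degree_one_surj F0 k v; subst v.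
exists (proj u); last by rewrite iter_proj.
by exists u => //; move: hv; rewrite /= !in_itv /= !iter_degree_one_le.
Qed.

End CircleMaps.

Section Atoms.
Variable R : realType.
Variable f : circle R -> circle R.
Local Notation proj := (@circle_proj R).
Local Notation F := (lift_of f).
Local Notation q := (return_time f).
Hypothesis hproj : forall t, proj (F t) = f (proj t).
Variables (f1 f2 f3 : R -> R) (N : nat) (c : 'I_N -> R).
Hypothesis hF : critical_lift F f1 f2 f3 c.
Hypothesis hper : forall q p t, (0 < q)%N -> ret F q p t != t.
Variable rho : R.
Hypothesis hrho : forall n, `|iter n F 0 - n%:R * rho| <= 1.
Hypothesis rhoE : rotation_number f = frac_part rho.
Local Notation G := (lift_ret F rho q).
Local Notation lo := (lift_lo F rho q).
Local Notation hi := (lift_hi F rho q).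
Local Notation len := (lift_len F rho q).

Let F0 := cl_degree hF.
Let q_0 : q 0%N = 1%N. Proof. by []. Qed.
Let q_1 : q 1%N = partial_quotient (frac_part rho) 0%N.
Proof. by rewrite /= rhoE. Qed.
Let q_SS n : q n.+2 = (partial_quotient (frac_part rho) n.+1 * q n.+1 + q n)%N.
Proof. by rewrite -rhoE. Qed.

Let even_order := even_order hF hper hrho q_0 q_1 q_SS.
Let odd_order := odd_order hF hper hrho q_0 q_1 q_SS.

Lemma proj_lift_ret n t : proj (G n t) = iter (q n) f (proj t).
Proof.
by rewrite (iter_proj hproj) /lift_ret /ret -mulrNz circle_proj_int.
Qed.

Lemma lift_lo_le_hi n t : lo n t <= hi n t < lo n t + 1.
Proof.
have [od|ev] := boolP (odd n).
  have [h1 h2 _] := odd_order t od.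
  by rewrite /lift_lo /lift_hi min_r ?max_l ?(ltW h1) //; lra.
have [h1 h2 _] := even_order t ev.
by rewrite /lift_lo /lift_hi min_l ?max_r ?(ltW h1) //; lra.
Qed.

Lemma closest_return_proj n t :
  closest_return_interval f n (proj t) = proj @` `[lo n t, hi n t].
Proof.
rewrite /closest_return_interval -!proj_lift_ret.
have [od|ev] := boolP (odd n); last first.
  have [h1 h2 h3] := even_order t ev.
  rewrite /lift_lo /lift_hi min_l ?max_r ?(ltW h1) //.
  rewrite circle_arc_proj ?(ltW h1) //.
  case: ifPn => // /asboolPn[]; exists (G n.+2 t) => //.
  by rewrite /= in_itv /=; lra.
have [h1 h2 h3] := odd_order t od.
rewrite /lift_lo /lift_hi min_r ?max_l ?(ltW h1) //.
case: ifPn => [/asboolP|_]; last first.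
  by rewrite circle_arc_proj ?(ltW h1) //; lra.
(* The positive arc from x to f^{q_n}(x) lifts to [t, G n t + 1]. No translate of G n.+2 t enters
   it, this point being strictly between G n t and t; so the test in the definition fails for odd
   n. *)
rewrite -(circle_proj_int (G n t) 1) circle_arc_proj; last 2 first.
- by rewrite -[1%:~R]/(1 : R); lra.
- by rewrite -[1%:~R]/(1 : R); lra.
move=> [u]; rewrite /= in_itv /= => hu /circle_proj_eq[k e].
exfalso; move: hu; rewrite e -[1%:~R]/(1 : R) => hu.
have k1 : (0%:~R : R) < k%:~R by rewrite -[0%:~R]/(0 : R); lra.
have k2 : (k%:~R : R) < 1%:~R by rewrite -[1%:~R]/(1 : R); lra.
by move: k1 k2; rewrite !ltr_int; lia.
Qed.

Lemma iter_lift_lo k n t : iter k F (lo n t) = lo n (iter k F t) /\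
  iter k F (hi n t) = hi n (iter k F t).
Proof.
have iF := iter_degree_one_le F0 k.
rewrite /lift_lo /lift_hi /lift_ret ret_iter //.
have [h|/ltW h] := leP t (ret F (q n) (return_shift rho q n) t); rewrite -iF in h.
  by rewrite min_l ?max_r.
by rewrite min_r ?max_l.
Qed.

Lemma atom_proj k n t : iter k f @` closest_return_interval f n (proj t) =
  proj @` `[lo n (iter k F t), hi n (iter k F t)].
Proof.
by rewrite closest_return_proj image_iter_proj //; have [-> ->] := iter_lift_lo k n t.
Qed.

Lemma circle_length_atom n t :
  circle_length (proj @` `[lo n t, hi n t]) = len n t.
Proof.
have /andP[h1 h2] := lift_lo_le_hi n t.
rewrite circle_length_proj // /lift_len distrC /lift_lo /lift_hi.
by have [h|h] := leP t (G n t); [rewrite ler0_norm|rewrite gtr0_norm]; lra.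
Qed.

Lemma atoms_meet n s m t :
  proj @` `[lo n s, hi n s] `&` proj @` `[lo m t, hi m t] !=set0 ->
  exists k : int, lift_meet F rho q n s m (t + k%:~R).
Proof.
move=> [_ [[u /= hu <-] [v /= hv]]] /circle_proj_eq[k e].
exists (- k); rewrite !in_itv /= in hu hv.
rewrite /lift_meet /lift_lo /lift_hi /lift_ret ret_int // -addr_minl -addr_maxl.
rewrite -/(lift_ret F rho q m t) -/(lift_ret F rho q n s) -/(lo m t) -/(hi m t) -/(lo n s)
  -/(hi n s).
by rewrite mulrNz; lra.
Qed.

(** One direction only, with a critical base point required for [D'] alone; the two-sided estimate
    comes from exchanging the two atoms. *)
Theorem atoms_comparable : exists2 K, 0 < K &
  forall (n : nat) (x y : circle R), f1 (repr y) = 0 ->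
  forall D D' : set (circle R),
    dynamical_partition f n x D -> dynamical_partition f n y D' ->
    D `&` D' !=set0 -> circle_length D <= K * circle_length D'.
Proof.
have [K K0 hK] := lift_bounds hF hper hrho q_0 q_1 q_SS.
exists K => // n x y hy D D'.
have len_int k t (m : int) : len k (t + m%:~R) = len k t.
  by rewrite /lift_len /lift_ret ret_int // opprD addrACA subrr addr0.
rewrite -(circle_proj_repr x) -(circle_proj_repr y).
have [hK1 hK2 hK3] := hK n; have [hK1' _ _] := hK n.+1.
move=> [[i _]|[i _]] <- [[j /= jq]|[j /= jq]] <-; rewrite !atom_proj => /atoms_meet[k hk];
  rewrite !circle_length_atom.
- by rewrite -(len_int n (iter j _ (repr y)) k); exact: hK1.
- by rewrite -(len_int n.+1 (iter j _ (repr y)) k); apply: hK3 => //; exact: ltnW.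
- by rewrite -(len_int n (iter j _ (repr y)) k); exact: hK2.
- by rewrite -(len_int n.+1 (iter j _ (repr y)) k); exact: hK1'.
Qed.

End Atoms.

Lemma is_derive_derive1n (R : realType) (F : R -> R) (k : nat) :
  (forall t : R, derivable (derive1n k F) t 1) ->
  forall t : R, is_derive t 1 (derive1n k F) (derive1n k.+1 F t).
Proof. by move=> h t; rewrite derive1nS derive1E; exact: derivableP. Qed.

Lemma multicritical_critical_lift (R : realType) (r : nat) (f : circle R -> circle R) :
  multicritical_circle_map r f ->
  [/\ forall t, circle_proj (lift_of f t) = f (circle_proj t),
      forall x, critical f x -> derive1n 1 (lift_of f) (repr x) = 0 &
      exists (N : nat) (c : 'I_N -> R),
        critical_lift (lift_of f) (derive1n 1 (lift_of f)) (derive1n 2 (lift_of f))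
          (derive1n 3 (lift_of f)) c].
Proof.
move=> [hh ho r3 [hder _] [N [c [W [[_ _ hcrit] hW hS hpow _]]]]].
have [F0 hproj] := lift_of_spec hh ho.
set F := lift_of f in hder F0 hproj *.
split=> //; exists N, (fun i => repr (c i)).
have F1 (t : R) : is_derive t 1 F (derive1n 1 F t).
  exact: (is_derive_derive1n (hder 0%N ltac:(lia))).
have F2 := is_derive_derive1n (hder 1%N ltac:(lia)).
have F3 := is_derive_derive1n (hder 2%N ltac:(lia)).
have p1 t : derive1n 1 F (t + 1) = derive1n 1 F t.
  by apply: (is_derive_periodic F1 (k := 1)); case: F0.
have p2 t : derive1n 2 F (t + 1) = derive1n 2 F t.
  by apply: (is_derive_periodic F2 (k := 0)) => u; rewrite addr0.
have p3 t : derive1n 3 F (t + 1) = derive1n 3 F t.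
  by apply: (is_derive_periodic F3 (k := 0)) => u; rewrite addr0.
have dE k t : (forall t, derive1n k F (t + 1) = derive1n k F t) ->
    circle_deriv f k (circle_proj t) = derive1n k F t.
  move=> hk; have [m e] := circle_proj_eq (circle_proj_repr (circle_proj t)).
  by rewrite /circle_deriv e (periodic_shift hk).
split=> //.
- move=> t; rewrite -(dE 1%N) //.
  have -> : circle_deriv f 1 (circle_proj t) = 0 <-> range c (circle_proj t).
    by rewrite -hcrit.
  split=> [[i _ e]|[i [m ->]]].
    have [m em] : exists m : int, t = repr (c i) + m%:~R.
      by apply: circle_proj_eq; rewrite circle_proj_repr.
    by exists i, m.
  by exists i => //; rewrite circle_proj_int circle_proj_repr.
move=> i; have [al [be [s [al0 albe s1 hp]]]] := hpow i.
have [oW Wc] := hW i.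
have : nbhs (repr (c i)) (@circle_proj R @^-1` W i).
  apply: open_nbhs_nbhs; split; last by rewrite /= circle_proj_repr.
  by move/continuousP : (@circle_proj_continuous R); apply.
rewrite -nbhs_ballE => -[e /= e0 he].
(* Within distance 1/2 the circle distance is the absolute value of the difference of lifts, and no
   other lift of the critical point occurs. *)
exists (Num.min e 2^-1), al, be, s; split=> //.
- by rewrite lt_min e0 /= invr_gt0.
- by rewrite al0.
move=> t tc; rewrite lt_min => /andP[te t2].
have Wt : W i (circle_proj t).
  by apply: (he t); rewrite -ball_normE /= distrC.
have ptc : circle_proj t <> c i.
  rewrite -(circle_proj_repr (c i)) => /circle_proj_eq[m em].
  have [m0|m0] := eqVneq m 0; first by apply: tc; rewrite em m0 addr0.
  move: t2; rewrite em addrAC subrr add0r -intr_norm.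
  have : 1 <= `|m| by lia.
  rewrite -(ler_int R); lra.
have := hp _ Wt ptc; have := hS i _ Wt ptc.
rewrite /schwarzian !dE // => h1.
by rewrite -[in circle_dist _ _](circle_proj_repr (c i)) circle_dist_near.
Qed.

Theorem lemma4p1 (R : realType) (r : nat) (f : circle R -> circle R)
    (hf : multicritical_circle_map r f) (hper : no_periodic_points f) :
  exists2 K : R, 1 < K &
    forall (n : nat) (c c' : circle R), critical f c -> critical f c' ->
    forall D D' : set (circle R),
      dynamical_partition f n c D -> dynamical_partition f n c' D' ->
      D `&` D' !=set0 ->
      K^-1 * circle_length D' <= circle_length D <= K * circle_length D'.
Proof.
have [hproj hcrit [N [c hF]]] := multicritical_critical_lift hf.
have F0 := cl_degree hF.
have hret q p t : (0 < q)%N -> ret (lift_of f) q p t != t.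
  move=> q0; apply/eqP => e; apply: (hper (circle_proj t) q q0).
  by rewrite iter_proj // -[in RHS]e /ret -mulrNz circle_proj_int.
have [rho hrho] := translation_number_exists F0.
have rhoE : rotation_number f = frac_part rho.
  by rewrite /rotation_number (translation_number_limit hrho).
have [K K0 hK] := atoms_comparable hproj hF hret hrho rhoE.
exists (K + 1); first by rewrite ltrDr.
move=> n x y hx hy D D' hD hD' DD'.
have h1 := hK n x y (hcrit _ hy) D D' hD hD' DD'.
have h2 : circle_length D' <= K * circle_length D.
  by apply: (hK n y x (hcrit _ hx)) => //; rewrite setIC.
have len0 A : 0 <= circle_length A :> R by rewrite /circle_length fine_ge0.
rewrite ler_pdivrMl ?addr_gt0 // !mulrDl mul1r.
have := len0 D; have := len0 D'; lra.
Qed.
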